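(* For every positive integer $i$ one has $$m_i=\inf_{p\in\Delta}\frac{a_i^2}{a_{i-1}a_{i+1}}=\frac{A_i^2}{A_{i-1}A_{i+1}}.$$ In other words, $m_i$ is attained at $p_{i+1}\in\Delta_{i+1}$; equivalently, the series $p_\infty(x)$ minimizes all the quantities $a_i^2/(a_{i-1}a_{i+1})$, $i\ge 1$, simultaneously. Moreover, $p_{i+1}$ is the unique polynomial in $\Delta_{i+1}$, up to a scaling $x\mapsto cx$, $c>0$, of the independent variable, that minimizes the quantity $a_i^2/(a_{i-1}a_{i+1})$ over $\Delta_{i+1}$.
   Context: A real polynomial is called hyperbolic if all its roots are real. For $n\ge 1$ let $\Delta_n$ be the set of polynomials $p(x)=1+a_1x+\dots+a_nx^n$ with $a_1,\dots,a_n>0$ that are section-hyperbolic, i.e. for every $i=1,\dots,n$ the section (truncation) $1+a_1x+\dots+a_ix^i$ is hyperbolic. Put $a_0=1$ and $\Delta=\bigcup_{n\ge1}\Delta_n$. For a positive integer $i$ set $m_i=\inf_{p\in\Delta} \frac{a_i^2}{a_{i-1}a_{i+1}}$, where the infimum is over those $p\in\Delta$ of degree at least $i+1$ and $a_j$ denotes the coefficient of $x^j$ in $p$. The polynomials $p_n$ are defined inductively by $p_1(x)=1+x$ and, for $n\ge2$, $p_n(x)=p_{n-1}(x)+A_nx^n$, where $A_n$ is the maximal positive number such that $p_n(x)$ is hyperbolic. Set $A_0=A_1=1$ and $p_\infty(x)=1+x+\sum_{n=2}^\infty A_nx^n$. (For instance $A_2=1/4$, $A_3=1/54$.) *)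

(* Defs.v *)
From HB Require Import structures.
From mathcomp Require Import all_boot all_order all_algebra.
From mathcomp Require Import complex.
From mathcomp Require Import boolp classical_sets reals.

Set Implicit Arguments.
Unset Strict Implicit.
Unset Printing Implicit Defensive.

Import Order.TTheory GRing.Theory Num.Theory.
Local Open Scope classical_set_scope.
Local Open Scope ring_scope.

(* "All its roots are real" refers to the complex roots: being without
   nonreal roots in R[i]. *)
Definition hyperbolic (R : realType) (p : {poly R}) : Prop :=
  forall z : R[i], root (map_poly (real_complex R) p) z -> complex.Im z = 0.

(* [take_poly i.+1 p] is the section of degree i (terms of degree <= i). *)
Definition Delta_ (R : realType) (n : nat) : set {poly R} :=
  [set p : {poly R} | [/\ size p = n.+1, p`_0 = 1,
     forall i : nat, (1 <= i <= n)%N -> 0 < p`_i &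
     forall i : nat, (1 <= i <= n)%N -> hyperbolic (take_poly i.+1 p)]].

Arguments Delta_ R n : clear implicits.

Definition Delta (R : realType) : set {poly R} :=
  \bigcup_(n in [set n : nat | (1 <= n)%N]) Delta_ R n.

Arguments Delta R : clear implicits.

(* Stated for a coefficient sequence, so that it applies both to polynomials
   (through [nth 0 p]) and to formal power series. *)
Definition coef_quotient (R : realType) (a : nat -> R) (i : nat) : R :=
  a i ^+ 2 / (a i.-1 * a i.+1).

(* [i.+1 < size p] says that the degree of p is at least i + 1. *)
Definition m_ (R : realType) (i : nat) : R :=
  inf [set coef_quotient (nth 0 p) i |
        p in [set p : {poly R} | Delta R p /\ (i.+1 < size p)%N]].

Definition is_max_coef (R : realType) (q : {poly R}) (n : nat) (c : R) : Prop :=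
  [/\ 0 < c, hyperbolic (q + c *: 'X^n) &
     forall c' : R, 0 < c' -> hyperbolic (q + c' *: 'X^n) -> c' <= c].

(* The value is 0 if there is no maximal coefficient; positivity of the
   coefficients of the resulting polynomial excludes this. *)
Definition max_coef (R : realType) (q : {poly R}) (n : nat) : R :=
  xget 0 [set c | is_max_coef q n c].

(* The sequence of polynomials starts at n = 1; the value at 0 is the
   constant term. *)
Fixpoint p_ (R : realType) (n : nat) : {poly R} :=
  match n with
  | 0 => 1
  | 1 => 1 + 'X
  | m.+1 => p_ R m + max_coef (p_ R m) m.+1 *: 'X^(m.+1)
  end.

Definition A_ (R : realType) (n : nat) : R :=
  if (n <= 1)%N then 1 else max_coef (p_ R n.-1) n.

(* The formal power series 1 + x + \sum_(n >= 2) A_n x^n, as its sequence of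
   coefficients (recall that A_0 = A_1 = 1). *)
Definition p_infty (R : realType) : nat -> R := A_ R.

Definition minimizes_on (R : realType) (D : set {poly R}) (i : nat)
    (p : {poly R}) : Prop :=
  D p /\ forall q : {poly R}, D q ->
    coef_quotient (nth 0 p) i <= coef_quotient (nth 0 q) i.

(* Main.v *)
Require Import Defs.
From HB Require Import structures.
From mathcomp Require Import all_boot all_order all_algebra.
From mathcomp Require Import complex.
From mathcomp Require Import boolp classical_sets reals.
From mathcomp Require Import topology normedtype derive.
From mathcomp Require Import ring lra.

Set Implicit Arguments.
Unset Strict Implicit.
Unset Printing Implicit Defensive.

Import Order.TTheory GRing.Theory Num.Theory numFieldNormedType.Exports.
Local Open Scope classical_set_scope.
Local Open Scope ring_scope.

(** Write [y_n = a_(n-1) a_(n+1) / a_n^2] for the reciprocals of the quotients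
    of a positive sequence [a] with [a_0 = 1], and [Y_n] for those of the
    sequence [A]. Up to scaling the variable, [a] is determined by the [y_n], so
    the theorem says that [y_i <= Y_i] whenever the sections of [a] are
    hyperbolic, with equality only if [y_j = Y_j] for all [j <= i].

    Let [psi_0 = 1] and [psi_(n+1)(s) = 1 - s psi_n(y_n s)]. The section of
    degree [n] of [a] at [- t] is [(-1)^n a_n t^n psi_n(a_(n-1) / (a_n t))]
    ([section_psi]), so hyperbolicity becomes a question about [psi_n] on the
    positive axis.

    Sufficient condition ([hyperbolic_of_humps]): if every [y_k] with [0 < k < n]
    is at most some value of [s psi_k(s)] on the unit interval, then the section
    of degree [n] has sufficiently many sign changes to be hyperbolic.
    Necessary conditions ([admissible_of_hyperbolic]): if the sections are
    hyperbolic, [psi_n] is a product of factors [1 - r s] with [r > 0] whose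
    first elementary symmetric functions are [1], [y_(n-1)] and
    [y_(n-1)^2 y_(n-2)]. For [n >= 3], estimates for the two largest [r] give a
    point [h] in [[2, 3]] with [psi_n(h) <= 0] and [y_(n-1) h <= 3/4]; at
    [s = y_(n-1) h] one finds [y_(n-1) <= s psi_(n-1)(s)]. Together the two facts show that the
    construction of the [p_n] never stops and that [Y_n] is the maximum of
    [s Psi_n(s)] on the unit interval, with [Psi] attached to [Y]
    ([A_structure]). Numerically, [Y_1 = 1/4] and [Y_n] lies between 0.292 and
    0.315 for [n >= 2].

    Comparison ([extremal_comparison]): let [e_n(s) = psi_n(y_n s) - Psi_n(Y_n s)].
    If [psi_(n+1)(h) <= 0], then [psi_n(y_n h) >= 1 / h >= Psi_n(Y_n h)], where
    the second inequality is the maximality of [Y_n]; thus [e_n(h) >= 0]. On the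
    other hand
      [e_n(s) = (Psi_n(y_n s) - Psi_n(Y_n s)) - y_n s e_(n-1)(y_n s)],
    so if [e_(n-1)] is nonnegative on [[0, 3/4]], the first difference is
    nonnegative at [h], and [y_n <= Y_n] because [Psi_n] decreases. To continue
    the induction one needs that [e_n] is again nonnegative on [[0, 3/4]]; this
    holds for the stronger quantitative property [error_control], which passes
    from [e_(n-1)] to [e_n] ([next_error_control]). If [y_n <= 1/4], the gap
    [Y_n - y_n] is large and the first difference dominates; otherwise the
    subtracted term, at most the first difference at [h], is smaller by a
    definite factor at the points [s <= 3/4], which are far below [h]. If
    [y_n = Y_n], the first difference vanishes, which forces [e_(n-1)] to vanish
    at [y_n h], hence [y_(n-1) = Y_(n-1)], and so on downwards. *)

(** * The polynomials psi *)

Section Psi.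
Variable R : realFieldType.
Implicit Types (y Y : nat -> R) (n : nat) (s x : R).

(** If [y] lists the reciprocals of the coefficient quotients of a positive
    sequence [a], then the section of degree [n] of [a], evaluated at [- t], is
    the value of [psi y n] at [a_(n-1) / (a_n t)], up to the sign and size of
    its leading term; see [section_psi]. *)
Fixpoint psi (y : nat -> R) (n : nat) : {poly R} :=
  if n is k.+1 then 1 - 'X * (psi y k \Po (y k *: 'X)) else 1.

Lemma psi0 y s : (psi y 0%N).[s] = 1. Proof. by rewrite hornerC. Qed.

Lemma psiS y n s : (psi y n.+1).[s] = 1 - s * (psi y n).[y n * s].
Proof. by rewrite /= !hornerE horner_comp !hornerE. Qed.

Lemma psi_at0 y n : (psi y n).[0] = 1.
Proof. by case: n => [|n]; rewrite ?psi0 // psiS mul0r subr0. Qed.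

(** The first [n] terms lie in the interval [0, 1/3], which makes [psi y n]
    monotone on the unit interval. *)
Definition thirds (y : nat -> R) n := forall j, (j < n)%N -> 0 <= y j <= 1/3.

Lemma thirdsS y n : thirds y n.+1 -> thirds y n.
Proof. by move=> h j jn; apply: h; rewrite ltnS ltnW. Qed.

(** On the unit interval [psi y n] has slopes between -1 and 0, and at most
    -1/3 if [0 < n]. *)
Lemma psi_lip y n : thirds y n -> forall x x' : R, 0 <= x -> x <= x' -> x' <= 1 ->
  [/\ 0 <= (psi y n).[x] - (psi y n).[x'], (psi y n).[x] - (psi y n).[x'] <= x' - x
   & (0 < n)%N -> (x' - x) / 3 <= (psi y n).[x] - (psi y n).[x']].
Proof.
elim: n => [|n IH] hy x x' x0 xx x1; first by rewrite !psi0 subrr; split => //; lra.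
have /andP[yn0 yn1] := hy n (ltnSn n).
have hy' := thirdsS hy.
have ypos t : 0 <= t -> 0 <= y n * t by move=> ?; rewrite mulr_ge0.
have y1 t : 0 <= t -> t <= 1 -> y n * t <= 1/3 by move=> ? ?; nra.
have yxx : y n * x <= y n * x' by rewrite ler_wpM2l.
have x'0 : 0 <= x' by lra.
have [|||g1 g2 _] := IH hy' (y n * x) (y n * x');
  [exact: ypos|exact: yxx|by have := y1 x'; lra|].
have [|||g3 g4 _] := IH hy' 0 (y n * x'); [lra|exact: ypos|by have := y1 x'; lra|].
rewrite psi_at0 in g3 g4; rewrite !psiS.
set u := (psi y n).[y n * x] in g1 g2 *; set v := (psi y n).[y n * x'] in g1 g2 g3 g4 *.
have yx' := y1 x' x'0 x1.
have h1 : x * (u - v) <= (x' - x) / 3.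
  have h : x * (u - v) <= x * (y n * x' - y n * x) by rewrite ler_wpM2l.
  apply: le_trans h _.
  have -> : x * (y n * x' - y n * x) = (x' - x) * (y n * x) by ring.
  rewrite ler_wpM2l ?subr_ge0 //.
  by have := y1 x; lra.
have h2 : 0 <= x * (u - v) by rewrite mulr_ge0.
have h3 : (x' - x) * (2/3) <= (x' - x) * v by rewrite ler_wpM2l ?subr_ge0 //; lra.
have h4 : (x' - x) * v <= (x' - x) * 1 by rewrite ler_wpM2l ?subr_ge0 //; lra.
have E : 1 - x * u - (1 - x' * v) = (x' - x) * v - x * (u - v) by ring.
by rewrite E; split; [lra|lra|move=> _; lra].
Qed.

Lemma psi_range y n x : thirds y n -> 0 <= x <= 1 -> 1 - x <= (psi y n).[x] <= 1.
Proof.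
move=> hy /andP[x0 x1]; have [//|//|//|] := @psi_lip y n hy 0 x.
by rewrite psi_at0 => ? ? _; apply/andP; split; lra.
Qed.

(** As long as [Y_m z w <= 1], the map [w |-> w^2 (1 - psi_m(Y_m z w))] is
    nondecreasing, with increments at most those of [w |-> Y_m z w^3]. This is
    the second order part of the change estimated in [term_change_bounds]. *)
Lemma cube_defect Y m (z v w : R) :
  thirds Y m.+1 -> 0 <= z -> 0 <= v <= w -> Y m * z * w <= 1 ->
  0 <= w ^+ 2 * (1 - (psi Y m).[Y m * z * w]) - v ^+ 2 * (1 - (psi Y m).[Y m * z * v])
    <= (w ^+ 3 - v ^+ 3) * (Y m * z).
Proof.
move=> hY z0 /andP[v0 vw] h1.
have /andP[Ym0 Ym1] := hY m (ltnSn m).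
have hY' := thirdsS hY.
have q0 : 0 <= Y m * z by rewrite mulr_ge0.
have w0 : 0 <= w by lra.
have qv0 : 0 <= Y m * z * v by rewrite mulr_ge0.
have qvw : Y m * z * v <= Y m * z * w by rewrite ler_wpM2l.
have [g1 _ _] := psi_lip hY' qv0 qvw h1.
have /andP[r1 r2] : 1 - Y m * z * v <= (psi Y m).[Y m * z * v] <= 1.
  by apply: psi_range => //; apply/andP; split => //; lra.
have v2w : v ^+ 2 <= w ^+ 2 by rewrite lerXn2r // nnegrE.
apply/andP; split.
  rewrite subr_ge0; apply: ler_pM => //; first exact: sqr_ge0.
    by lra.
  by lra.
case: m {hY} hY' h1 Ym0 Ym1 q0 qv0 qvw g1 r1 r2 => [|k] hY h1 Ym0 Ym1 q0 qv0 qvw g1 r1 r2.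
  rewrite !psi0 subrr !mulr0 subrr mulr_ge0 //.
  by rewrite subr_ge0 lerXn2r // nnegrE.
rewrite !psiS; set q := Y k.+1 * z in h1 q0 qv0 qvw *.
have /andP[Yk0 Yk1] := hY k (ltnSn k).
have hY' := thirdsS hY.
have [|||g2 _ _] := psi_lip hY' (x := Y k * (q * v)) (x' := Y k * (q * w)); first
  by rewrite mulr_ge0.
- by rewrite ler_wpM2l.
- have qw0 : 0 <= q * w by rewrite mulr_ge0.
  by nra.
have /andP[_ r3] : 1 - Y k * (q * v) <= (psi Y k).[Y k * (q * v)] <= 1.
  by apply: psi_range => //; apply/andP; split; [rewrite mulr_ge0|nra].
set a := (psi Y k).[_] in g2 r3 *; set b := (psi Y k).[_] in g2 *.
have -> : w ^+ 2 * (1 - (1 - q * w * b)) - v ^+ 2 * (1 - (1 - q * v * a)) =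
  (w ^+ 3 - v ^+ 3) * q * a - q * w ^+ 3 * (a - b) by ring.
have v3w : 0 <= w ^+ 3 - v ^+ 3 by rewrite subr_ge0 lerXn2r // nnegrE.
have h2 : 0 <= q * w ^+ 3 * (a - b) by rewrite !mulr_ge0 // exprn_ge0.
have h3 : (w ^+ 3 - v ^+ 3) * q * a <= (w ^+ 3 - v ^+ 3) * q * 1.
  by rewrite ler_wpM2l // mulr_ge0.
lra.
Qed.

(** First and second order estimates for the change of [psi] when the factor
    [Y_(m+2)] of its argument is lowered to [y]. *)
Lemma term_change_bounds Y m (y s d p A : R) : thirds Y m.+3 ->
  0 <= y <= Y m.+2 -> 0 <= s <= 3 ->
  d = Y m.+2 - y -> p = (Y m.+2 + y) * Y m.+1 ->
  A = (Y m.+2 ^+ 2 + Y m.+2 * y + y ^+ 2) * Y m.+1 ^+ 2 * Y m ->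
  s * d * (1 - p * s) <= (psi Y m.+2).[y * s] - (psi Y m.+2).[Y m.+2 * s]
    <= s * d * (1 - p * s + A * s ^+ 2).
Proof.
move=> hY /andP[y0 yY] /andP[s0 s1] -> -> ->.
have /andP[Y20 Y21] := hY m.+2 (ltnSn _).
have /andP[Y10 Y11] : 0 <= Y m.+1 <= 1/3 by apply: hY; rewrite ltnS ltnW.
have /andP[Y00 Y01] : 0 <= Y m <= 1/3 by apply: hY; rewrite ltnS ltnW // ltnW.
have z0 : 0 <= Y m.+1 * s by rewrite mulr_ge0.
have h1 : Y m * (Y m.+1 * s) * Y m.+2 <= 1.
  have h : Y m.+1 * s <= 1 by nra.
  have h' : Y m * (Y m.+1 * s) <= 1 by nra.
  have : 0 <= Y m * (Y m.+1 * s) by rewrite mulr_ge0.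
  by nra.
have := @cube_defect Y m (Y m.+1 * s) y (Y m.+2) (thirdsS (thirdsS hY)) z0
  (introT andP (conj y0 yY)) h1.
rewrite !psiS.
have -> : Y m * (Y m.+1 * (Y m.+2 * s)) = Y m * (Y m.+1 * s) * Y m.+2 by ring.
have -> : Y m * (Y m.+1 * (y * s)) = Y m * (Y m.+1 * s) * y by ring.
set a := (psi Y m).[_]; set b := (psi Y m).[_].
move=> /andP[g1 g2].
have hz : 0 <= Y m.+1 * s ^+ 2 by rewrite mulr_ge0 // sqr_ge0.
have {}g1 := mulr_ge0 hz g1.
have {}g2 := ler_wpM2l hz g2.
apply/andP; split; lra.
Qed.

(** The difference of the two [psi] of index [n], each at [s] times its own term
    of index [n], as in the recursion [psiS]. *)
Definition error y Y n s : R := (psi y n).[y n * s] - (psi Y n).[Y n * s].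

Lemma error_recursion y Y n s : error y Y n.+1 s =
  ((psi Y n.+1).[y n.+1 * s] - (psi Y n.+1).[Y n.+1 * s]) -
  y n.+1 * s * error y Y n (y n.+1 * s).
Proof. by rewrite /error !psiS; ring. Qed.

End Psi.

(** * One step of the comparison *)

Section OneStep.
Variable R : realFieldType.
Implicit Types (e D : R -> R) (y d s : R).

(** What the induction knows about the error function [e] attached to two
    sequences whose current terms are [y] and [y + d]: on the interval [0, 3/4]
    the ratio [e s / s] lies between [d / 3] and [d]; at a point [x <= 7/20 s]
    the value of [e] is at most seven tenths of [e s], while [e x / x] is at
    least [e s / s]; and a sharper lower bound holds when [y <= 1/4]. *)
Definition error_control e (y d : R) : Prop :=
  forall x s, 0 <= s <= 3/4 -> 0 <= x <= 7/20 * s ->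
  [/\ e x <= 7/10 * e s, x * e s <= s * e x, s * d / 3 <= e s <= s * d &
      y <= 1/4 -> s * d * (1 - 2/3 * s) <= e s].

Lemma error_control_ext e e' y d : e =1 e' -> error_control e y d -> error_control e' y d.
Proof. by move=> ee h x s hs hx; rewrite -!ee; apply: h. Qed.

Lemma quadratic_coef_bound (y Y Yp Ypp : R) : 1/4 <= y <= Y -> Y <= 63/200 -> 0 <= Yp ->
  0 <= Ypp <= 63/200 ->
  (Y ^+ 2 + Y * y + y ^+ 2) * Yp ^+ 2 * Ypp <= 6/25 * ((Y + y) * Yp) ^+ 2.
Proof.
move=> /andP[y1 yY] Y1 Yp0 /andP[Ypp0 Ypp1].
have h : Y ^+ 2 + Y * y + y ^+ 2 <= 19/25 * (Y + y) ^+ 2 by clear -y1 yY Y1; nra.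
have h3 : 0 <= (Y + y) ^+ 2 * Yp ^+ 2 by rewrite mulr_ge0 // sqr_ge0.
have h4 : (Y ^+ 2 + Y * y + y ^+ 2) * Yp ^+ 2 <= 19/25 * ((Y + y) ^+ 2 * Yp ^+ 2).
  by rewrite [leRHS]mulrA ler_wpM2r // sqr_ge0.
have h5 : 0 <= (Y ^+ 2 + Y * y + y ^+ 2) * Yp ^+ 2.
  by rewrite mulr_ge0 ?sqr_ge0 //; clear -y1 yY; nra.
by rewrite exprMn; clear -h3 h4 h5 Ypp0 Ypp1; nra.
Qed.

(** The factor that decides the contraction by seven tenths in [ratio_step]. *)
Lemma ratio_factor_ge0 (p A g r s : R) : 0 <= A <= 1 -> 0 <= p -> 0 <= r <= 7/20 ->
  0 <= s <= 3/4 -> g + 3/4 * p <= 121/200 - A / 20 ->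
  0 <= 7/10 * (1 - p * s) - r * (1 - p * (r * s) + A * (r * s) ^+ 2) - (7/10 - r ^+ 2) * g.
Proof.
move=> /andP[A0 A1] p0 /andP[r0 r1] /andP[s0 s1] hB.
have -> : 7/10 * (1 - p * s) - r * (1 - p * (r * s) + A * (r * s) ^+ 2) -
    (7/10 - r ^+ 2) * g = 7/10 - r - (7/10 - r ^+ 2) * (g + p * s) - A * (r ^+ 3 * s ^+ 2) by field.
have h1 : g + p * s <= 121/200 - A / 20 by clear -p0 s1 hB; nra.
have h2 : 1/2 <= 7/10 - r ^+ 2 by clear -r0 r1; nra.
have h3 : r ^+ 3 * s ^+ 2 <= 1/40.
  have s2 : s ^+ 2 <= 9/16 by clear -s0 s1; nra.
  have s20 : 0 <= s ^+ 2 by rewrite sqr_ge0.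
  have r2 : r ^+ 3 <= 343/8000 by clear -r0 r1; rewrite exprS; nra.
  have r3 : 0 <= r ^+ 3 by rewrite exprn_ge0.
  by clear -s2 s20 r2 r3; nra.
have h4 : (7/10 - r ^+ 2) * (g + p * s) <= (7/10 - r ^+ 2) * (121/200 - A/20).
  by apply: ler_wpM2l => //; clear -h2; lra.
have h5 : A * (r ^+ 3 * s ^+ 2) <= A * (1/40) by rewrite ler_wpM2l.
have h6 : 0 <= 7/10 - r - (7/10 - r ^+ 2) * (121/200) by clear -r0 r1; nra.
have h7 : A * (1/40) <= (7/10 - r ^+ 2) * (A / 20) by clear -A0 h2; nra.
by clear -h4 h5 h6 h7; lra.
Qed.

(** With [x = r * s], [G] the subtracted quotient at [s], [u] the new error at
    [x] and [v] the new error at [s]: the first clause of [error_control]. *)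
Lemma ratio_step (p A d g G r s u v : R) :
  0 <= A <= 1 -> 0 <= p -> 0 <= d -> 0 <= r <= 7/20 -> 0 <= s <= 3/4 ->
  g + 3/4 * p <= 121/200 - A / 20 -> G <= d * g ->
  u <= r * s * (d * (1 - p * (r * s) + A * (r * s) ^+ 2) - r * G) ->
  s * (d * (1 - p * s) - G) <= v -> u <= 7/10 * v.
Proof.
move=> A01 p0 d0 r01 s01 hg Gg hu hv.
have hf := ratio_factor_ge0 A01 p0 r01 s01 hg.
have hv' : 7/10 * (s * (d * (1 - p * s) - G)) <= 7/10 * v.
  by apply: ler_wpM2l => //; clear; lra.
apply: le_trans hu (le_trans _ hv').
rewrite -subr_ge0.
have -> : 7/10 * (s * (d * (1 - p * s) - G)) -
    r * s * (d * (1 - p * (r * s) + A * (r * s) ^+ 2) - r * G) =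
  s * (d * (7/10 * (1 - p * s) - r * (1 - p * (r * s) + A * (r * s) ^+ 2) -
     (7/10 - r ^+ 2) * g) + (7/10 - r ^+ 2) * (d * g - G)) by ring.
case/andP: s01 => s0 _; rewrite mulr_ge0 // addr_ge0 // mulr_ge0 // ?subr_ge0 //.
by case/andP: r01 => r0 r1; clear -r0 r1; nra.
Qed.

(** Data of one induction step. [e] is the previous error, controlled with the
    previous term [yp] and gap [d'] ; [y] and [d] are the new term and gap,
    [D] is the contribution of the change of term alone, with its second order
    expansion given by [p] and [A], and [sh] is a point where the new error is
    known to be nonnegative. *)
Record step_data (e D : R -> R) (y yp d d' p A sh : R) : Prop := StepData {
  step_y : 0 < y <= 1/3;
  step_d : 0 <= d;
  step_d' : 0 <= d' <= 63/200;
  step_p : 0 <= p <= 1/5;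
  step_A : 0 <= A <= p / 15;
  step_e : error_control e yp d';
  step_D : forall s, 0 <= s <= 3 ->
    s * d * (1 - p * s) <= D s <= s * d * (1 - p * s + A * s ^+ 2);
  step_sh : 2 <= sh <= 3;
  step_ysh : y * sh <= 3/4;
  step_Dsh : y * sh * e (y * sh) <= D sh;
  step_small : y <= 1/4 -> 21/500 <= d /\ p <= 178/1000;
  step_big : 1/4 < y -> A <= 6/25 * p ^+ 2 /\
    ((15/7 <= sh /\ 158/1000 <= p) \/ [/\ y <= 8/27, yp <= 1/4 & 1/10 <= p]) }.

(** The right hand side of [error_recursion]. *)
Definition next_error e D (y s : R) : R := D s - y * s * e (y * s).

Lemma error_bounds e y d s : error_control e y d -> 0 <= s <= 3/4 ->
  s * d / 3 <= e s <= s * d.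
Proof.
move=> he s0; have x0 : (0 : R) <= 0 <= 7/20 * s.
  by case/andP: s0 => s0 _; rewrite lexx mulr_ge0 ?divr_ge0.
by have [] := he _ _ s0 x0.
Qed.

Lemma next_error_small e D y yp d d' p A sh : step_data e D y yp d d' p A sh ->
  y <= 1/4 -> forall s, 0 <= s <= 3/4 ->
  s * d * (1 - 2/3 * s) <= next_error e D y s.
Proof.
case=> /andP[y0 _] d0 /andP[d'0 d'1] /andP[p0 _] _ he DE _ _ _ small _.
move=> y4 s /andP[s0 s1]; have [d1 p1] := small y4.
have ys0 : 0 <= y * s by rewrite mulr_ge0 // ltW.
have ys1 : y * s <= 3/4 by clear -y0 y4 s0 s1; nra.
have /andP[_ hes] := error_bounds he (introT andP (conj ys0 ys1)).
have s3 : 0 <= s <= 3 by apply/andP; split=> //; clear -s1; lra.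
have /andP[hD _] := DE _ s3.
rewrite /next_error.
have h1 : y * s * e (y * s) <= y * s * (y * s * d') by apply: ler_wpM2l.
have h2 : y * s * (y * s * d') <= s ^+ 2 * (63/3200).
  have -> : y * s * (y * s * d') = s ^+ 2 * (y ^+ 2 * d') by ring.
  apply: ler_wpM2l; first by rewrite sqr_ge0.
  have y2 : y ^+ 2 <= 1/16 by clear -y0 y4; nra.
  by have := sqr_ge0 y; clear -y2 d'0 d'1; nra.
have h3 : s ^+ 2 * (63/3200) <= s ^+ 2 * ((2/3 - p) * d).
  by apply: ler_wpM2l; [rewrite sqr_ge0|clear -d1 p0 p1; nra].
have -> : s * d * (1 - 2/3 * s) = s * d * (1 - p * s) - s ^+ 2 * ((2/3 - p) * d) by ring.
by clear -hD h1 h2 h3; lra.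
Qed.

(** Past [1/4] the subtracted term is bounded by its value at [y * sh], up to a
    contraction factor: seven tenths in general, and 31/50, from the sharper
    lower bound on [e], when the previous term is at most [1/4]. *)
Lemma subtracted_bound e D y yp d d' p A sh : step_data e D y yp d d' p A sh ->
  1/4 < y -> exists2 g, g + 3/4 * p <= 121/200 - A / 20 &
  forall s, 0 <= s <= 3/4 -> y * e (y * s) <= d * g.
Proof.
case=> /andP[y0 y1] d0 /andP[d'0 d'1] /andP[p0 p1'] /andP[A0 A1] he DE /andP[sh2 sh3].
move=> ysh Dsh _ big y4.
have sh_gt0 : 0 < sh by clear -sh2; lra.
have sh03 : 0 <= sh <= 3 by rewrite ltW ?sh3.
have ysh0 : 0 <= y * sh by rewrite mulr_ge0 // ltW.
have hsh : y * e (y * sh) <= d * (1 - p * sh + A * sh ^+ 2).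
  have /andP[_ hD] := DE sh sh03.
  rewrite -(@ler_pM2l _ sh) // mulrA [sh * y]mulrC (le_trans Dsh) // (le_trans hD) //.
  by rewrite [leRHS]mulrA.
have [A2 [[h7 p1]|[y27 yp4 p1]]] := big y4.
  (* here [sh >= 15/7] makes [y * s <= 7/20 * (y * sh)] for all [s <= 3/4] *)
  exists (7/10 * (1 - p * (15/7) + A * (15/7) ^+ 2)); first by clear -A2 p1 p1' A0; nra.
  move=> s /andP[s0 s1].
  have ys_ge0 : 0 <= y * s by rewrite mulr_ge0 // ltW.
  have ys_le : y * s <= 7/20 * (y * sh).
    have -> : 7/20 * (y * sh) = y * (7/20 * sh) by ring.
    by apply: ler_wpM2l; [exact: ltW|clear -s1 h7; lra].
  have [||h _ _ _] := he (y * s) (y * sh); [exact/andP|exact/andP|].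
  have h2 : 1 - p * sh + A * sh ^+ 2 <= 1 - p * (15/7) + A * (15/7) ^+ 2.
    have -> : 1 - p * (15/7) + A * (15/7) ^+ 2 = 1 - p * sh + A * sh ^+ 2 +
      (sh - 15/7) * (p - A * (sh + 15/7)) by field.
    have : A * (sh + 15/7) <= p by clear -A0 A1 sh3 sh2; nra.
    by clear -h7; nra.
  have h3 : y * e (y * s) <= y * (7/10 * e (y * sh)) by rewrite ler_wpM2l // ltW.
  have h4 : d * (1 - p * sh + A * sh ^+ 2) <= d * (1 - p * (15/7) + A * (15/7) ^+ 2).
    exact: ler_wpM2l.
  by clear -h3 hsh h4; lra.
exists (31/50 * (1 - p * 2 + A * 2 ^+ 2)); first by clear -A2 p1 p1' A0; nra.
move=> s /andP[s0 s1].
have h2 : 1 - p * sh + A * sh ^+ 2 <= 1 - p * 2 + A * 2 ^+ 2.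
  have -> : 1 - p * 2 + A * 2 ^+ 2 = 1 - p * sh + A * sh ^+ 2 +
    (sh - 2) * (p - A * (sh + 2)) by ring.
  have : A * (sh + 2) <= p by clear -A0 A1 sh3 sh2; nra.
  by clear -sh2; nra.
have ys_ge0 : 0 <= y * s by rewrite mulr_ge0 // ltW.
have ys_le : y * s <= 3/4 by clear -y0 y1 s0 s1; nra.
have /andP[_ hes] := error_bounds he (introT andP (conj ys_ge0 ys_le)).
have x0 : (0 : R) <= 0 <= 7/20 * (y * sh) by rewrite lexx mulr_ge0 ?divr_ge0.
have [_ _ _ /(_ yp4) h] := he 0 (y * sh) (introT andP (conj ysh0 ysh)) x0.
have h3 : 3/4 <= 31/50 * (sh * (1 - 2/3 * (y * sh))).
  have : 3/4 <= 31/50 * (sh * (1 - 2/3 * (8/27 * sh))) by clear -sh2 sh3; nra.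
  by clear -y27 sh2; nra.
have h5 : e (y * s) <= 31/50 * e (y * sh).
  have h6 : y * s * d' <= y * d' * (31/50 * (sh * (1 - 2/3 * (y * sh)))).
    rewrite mulrAC ler_wpM2l ?mulr_ge0 ?(ltW y0) //.
    exact: le_trans h3.
  by clear -h h6 hes; lra.
have h7 : y * e (y * s) <= y * (31/50 * e (y * sh)) by rewrite ler_wpM2l // ltW.
have h4 : d * (1 - p * sh + A * sh ^+ 2) <= d * (1 - p * 2 + A * 2 ^+ 2).
  exact: ler_wpM2l.
by clear -h7 hsh h4; lra.
Qed.

(** The induction step: the control of the error passes to the next index. *)
Lemma next_error_control e D y yp d d' p A sh : step_data e D y yp d d' p A sh ->
  error_control (next_error e D y) y d.
Proof.
move=> H; have GB := subtracted_bound H; have SS := next_error_small H.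
case: H => /andP[y0 y1] d0 /andP[d'0 _] /andP[p0 p1] /andP[A0 A1] he DE _ _ _ _ _.
move=> x s /andP[s0 s1] /andP[x0 xs].
have x_le_s : x <= s by clear -s0 xs; lra.
have s03 : 0 <= s <= 3 by apply/andP; split=> //; clear -s1; lra.
have x03 : 0 <= x <= 3 by apply/andP; split=> //; clear -s1 x_le_s; lra.
have ys_ge0 : 0 <= y * s by rewrite mulr_ge0 // ltW.
have ys_le : y * s <= 1/4 by clear -y0 y1 s0 s1; nra.
have yx_ge0 : 0 <= y * x by rewrite mulr_ge0 // ltW.
have yx_le : y * x <= 7/20 * (y * s) by rewrite mulrCA ler_pM2l.
have ys_le' : y * s <= 3/4 by clear -ys_le; lra.
have yx_le' : y * x <= 3/4 by clear -yx_le ys_le' ys_ge0; lra.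
have [||g1 g2 /andP[g3 g4] _] := he (y * x) (y * s); [exact/andP|exact/andP|].
have es0 : 0 <= e (y * s) by apply: le_trans g3; rewrite divr_ge0 // mulr_ge0.
have /andP[Dx1 Dx2] := DE x x03.
have /andP[Ds1 Ds2] := DE s s03.
have ex0 : 0 <= e (y * x).
  have /andP[+ _] := error_bounds he (introT andP (conj yx_ge0 yx_le')).
  by apply: le_trans; rewrite divr_ge0 // mulr_ge0.
have A01 : 0 <= A <= 1 by rewrite A0; clear -A1 p1; lra.
have quad (t : R) : 0 <= t -> t <= 3/4 -> 1 - p * t + A * t ^+ 2 <= 1.
  move=> t0 t1; have : A * t <= p by clear -A0 A1 t0 t1; nra.
  by clear -t0; nra.
have sd0 : 0 <= s * d by rewrite mulr_ge0.
have xd0 : 0 <= x * d by rewrite mulr_ge0.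
have up t : 0 <= t -> t <= 3/4 -> 0 <= y * t * e (y * t) ->
    D t <= t * d * (1 - p * t + A * t ^+ 2) -> next_error e D y t <= t * d.
  move=> t0 t1 he0 hD.
  have : t * d * (1 - p * t + A * t ^+ 2) <= t * d * 1.
    by apply: ler_wpM2l; [rewrite mulr_ge0|exact: quad].
  by rewrite /next_error; clear -he0 hD; lra.
have ups : next_error e D y s <= s * d by apply: up => //; rewrite mulr_ge0.
have upx : next_error e D y x <= x * d.
  by apply: up => //; [exact: le_trans s1|rewrite mulr_ge0].
have I2 : x * next_error e D y s <= s * next_error e D y x.
  rewrite /next_error.
  have h1 : x * D s <= s * D x.
    have h2 : x * D s <= x * (s * d * (1 - p * s + A * s ^+ 2)) by apply: ler_wpM2l.
    have h3 : s * (x * d * (1 - p * x)) <= s * D x by apply: ler_wpM2l.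
    have h4 : A * s ^+ 2 <= p / 15 * s ^+ 2 by rewrite ler_wpM2r // sqr_ge0.
    have h5 : p * (s ^+ 2 / 15) <= p * (s - x).
      by apply: ler_wpM2l => //; clear -s0 s1 xs; nra.
    have h6 : x * s * d * (1 - p * s + A * s ^+ 2) <= x * s * d * (1 - p * x).
      by apply: ler_wpM2l; [rewrite !mulr_ge0|clear -h4 h5; lra].
    by clear -h2 h3 h6; lra.
  have h2 : e (y * x) <= e (y * s) by clear -g1 es0; lra.
  have h3 : (x * s * y) * e (y * x) <= (x * s * y) * e (y * s).
    by apply: ler_wpM2l => //; rewrite !mulr_ge0 // ltW.
  by clear -h1 h3; lra.
have [y4|y4] := leP y (1/4).
  have low := SS y4 s (introT andP (conj s0 s1)).
  have lowh : s * d * (1/2) <= next_error e D y s.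
    by apply: le_trans low; apply: ler_wpM2l => //; clear -s1; lra.
  have xsd : x * d <= 7/20 * s * d by apply: ler_wpM2r.
  split=> //; first by clear -upx lowh xsd; lra.
  by apply/andP; split=> //; clear -lowh sd0; lra.
have [g hg Gg] := GB y4.
have Gs := Gg s (introT andP (conj s0 s1)).
set G := y * e (y * s) in Gs.
have e'E : next_error e D y s = D s - s * G by rewrite /next_error /G; ring.
have low : s * d / 3 <= next_error e D y s.
  rewrite e'E.
  have h1 : s * G <= s * (d * g) by apply: ler_wpM2l.
  have h2 : 0 <= s * d * (1 - p * s - g - 1/3).
    by rewrite mulr_ge0 //; clear -hg p0 s0 s1 A0; nra.
  by clear -Ds1 h1 h2; lra.
split; [|exact: I2|by apply/andP; split|by []].
have [s00|sn0] := eqVneq s 0.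
  have x00 : x = 0 by apply/eqP; rewrite eq_le x0 -s00 x_le_s.
  by move: low upx; rewrite s00 x00 !mul0r; clear; lra.
have sgt : 0 < s by rewrite lt_neqAle eq_sym sn0.
have xE : x = x / s * s by rewrite mulfVK.
have r01 : 0 <= x / s <= 7/20 by rewrite divr_ge0 //= ler_pdivrMr.
apply: (@ratio_step p A d g G (x / s) s) => //; first exact/andP.
  rewrite -xE /next_error.
  have h1 : x * (x / s * G) <= x * (y * e (y * x)).
    rewrite ler_wpM2l // -(@ler_pM2l _ s) //.
    have -> : s * (x / s * G) = y * x * e (y * s)
      by rewrite mulrA [s * _]mulrC -xE /G; ring.
    by rewrite (le_trans g2) // mulrA [s * y]mulrC.
  rewrite mulrBr.
  have -> : x * (d * (1 - p * x + A * x ^+ 2)) = x * d * (1 - p * x + A * x ^+ 2) by ring.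
  by apply: lerB => //; apply: le_trans h1 _; rewrite mulrA [x * y]mulrC.
by rewrite e'E mulrBr mulrA lerB.
Qed.

End OneStep.

(** * The comparison theorem *)

Section Compare.
Variable R : realFieldType.
Implicit Types (y Y : nat -> R) (n N : nat).

(** Consequences of the hyperbolicity of the sections for the reciprocal
    quotients [y_1, ..., y_N], see [admissible_of_hyperbolic]: numerical bounds,
    and for each index a point [sh] of a fixed window at which the next [psi]
    is nonpositive. *)
Definition admissible y N :=
  [/\ y 0%N = 0, (0 < N)%N -> y 1%N <= 1/4,
      forall n, (0 < n <= N)%N -> 0 < y n <= 63/200 &
      forall n, (n.+2 <= N)%N -> exists sh : R,
        [/\ 2 <= sh <= 3, y n.+2 * sh <= 3/4, (psi y n.+3).[sh] <= 0,
            1/4 < y n.+2 -> 1/4 < y n.+1 -> 15/7 <= sh &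
            y n.+1 <= 1/4 -> y n.+2 <= 8/27]].

(** The properties of the extremal sequence used in the comparison; the last
    one says that [Y_n] is at least the maximum on the unit interval of
    [s * psi_n(s)], called the hump of index [n] below. *)
Definition extremal Y N :=
  [/\ Y 0%N = 0, (0 < N)%N -> Y 1%N = 1/4,
      forall n, (1 < n <= N)%N -> 292/1000 <= Y n <= 63/200 &
      forall n (s : R), (0 < n <= N)%N -> 0 <= s <= 1 -> s * (psi Y n).[s] <= Y n].

Lemma extremal_thirds Y N : extremal Y N -> thirds Y N.+1.
Proof.
case=> Y0 Y1 Y2 _ [|[|j]]; rewrite ?ltnS => jN.
- by rewrite Y0; lra.
- by rewrite Y1 //; lra.
- by have := Y2 j.+2 jN; lra.
Qed.

(** Numerical bounds on the coefficients [p] and [A] of [term_change_bounds]. *)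
Lemma expansion_coef_bounds (y Y Yp Ypp p A : R) : 0 <= y <= Y ->
  292/1000 <= Y <= 63/200 -> 1/4 <= Yp <= 63/200 -> 0 <= Ypp <= 63/200 ->
  p = (Y + y) * Yp -> A = (Y ^+ 2 + Y * y + y ^+ 2) * Yp ^+ 2 * Ypp ->
  [/\ 0 <= p <= 1/5, 0 <= A <= p / 15, y <= 1/4 -> 21/500 <= Y - y /\ p <= 178/1000,
      1/4 < y -> A <= 6/25 * p ^+ 2 /\ 1/10 <= p &
      1/4 < y -> 292/1000 <= Yp -> 158/1000 <= p].
Proof.
move=> /andP[y0 yY] /andP[Y0 Y1] /andP[Yp0 Yp1] /andP[Q0 Q1] pE AE.
have p0 : 0 <= p by rewrite pE mulr_ge0 //; lra.
have p1 : p <= 1/5 by rewrite pE; nra.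
have hq : Y ^+ 2 + Y * y + y ^+ 2 <= (Y + y) ^+ 2 by nra.
have hq0 : 0 <= Y ^+ 2 + Y * y + y ^+ 2 by nra.
have h1 : (Y ^+ 2 + Y * y + y ^+ 2) * Yp ^+ 2 <= p ^+ 2.
  by rewrite pE exprMn ler_wpM2r // sqr_ge0.
have h2 : p ^+ 2 <= p / 5 by nra.
have h3 : A <= p / 5 * (63/200).
  rewrite AE; apply: ler_pM => //; first by rewrite mulr_ge0 // sqr_ge0.
  exact: le_trans h2.
split.
- exact/andP.
- apply/andP; split; last by lra.
  by rewrite AE mulr_ge0 // mulr_ge0 // sqr_ge0.
- by move=> y4; split; [lra|rewrite pE; nra].
- move=> y4; split; last by rewrite pE; nra.
  rewrite AE pE; apply: quadratic_coef_bound => //; [|lra|exact/andP].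
  by apply/andP; split => //; apply: ltW.
- by move=> y4 Yp2; rewrite pE; nra.
Qed.

(** The terms of an admissible sequence are bounded by those of an extremal
    one, and equality at one index forces equality at all smaller indices. *)
Lemma extremal_comparison y Y N : admissible y N -> extremal Y N ->
  forall n, (n < N)%N ->
  [/\ 0 <= Y n.+1 - y n.+1,
      error_control (error y Y n.+1) (y n.+1) (Y n.+1 - y n.+1) &
      y n.+1 = Y n.+1 -> forall j, (j <= n.+1)%N -> y j = Y j].
Proof.
move=> [y00 y11 yb yw] extY; have Y3 := extremal_thirds extY.
have [Y00 Y11 Yb Ym] := extY.
elim=> [|n IH] nN.
  have {}y11 := y11 nN; have {}Y11 := Y11 nN.
  split; first by rewrite Y11 subr_ge0.
  - apply: (@error_control_ext R (fun s : R => (Y 1%N - y 1%N) * s)).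
      by move=> s; rewrite /error !psiS !psi0; ring.
    have : 0 <= Y 1%N - y 1%N by rewrite Y11 subr_ge0.
    set d := Y 1%N - y 1%N => d0 x s /andP[s0 s1] /andP[x0 x1].
    have xs : x <= s by lra.
    have dx : d * x <= d * (7/20 * s) by rewrite ler_wpM2l.
    have ds : 0 <= d * s by rewrite mulr_ge0.
    have dss : 0 <= d * s * s by rewrite mulr_ge0.
    clear - dx ds dss; split; [lra|lra|apply/andP; split; lra|move=> _; lra].
  - by move=> yY [|[|//]] _; rewrite ?y00 ?Y00.
have {}Y11 := Y11 (leq_ltn_trans (leq0n _) nN).
have [d'0 he eqe] := IH (ltnW nN).
have /andP[ygt0 yle] : 0 < y n.+2 <= 63/200 by apply: yb.
have /andP[ypgt0 yple] : 0 < y n.+1 <= 63/200 by apply: yb; rewrite (ltnW nN).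
have /andP[Y2l Y2u] : 292/1000 <= Y n.+2 <= 63/200 by apply: Yb.
have /andP[Y1l Y1u] : 1/4 <= Y n.+1 <= 63/200.
  case: (n) nN => [|k] nN; first by rewrite Y11; apply/andP; split; clear; lra.
  have /andP[] := Yb k.+2 (ltnW nN).
  by move=> h1 h2; apply/andP; split => //; clear - h1; lra.
have /andP[Y0l Y0u] : 0 <= Y n <= 63/200.
  case: (n) nN => [|[|k]] nN; first by rewrite Y00; apply/andP; split; clear; lra.
    by rewrite Y11; apply/andP; split; clear; lra.
  by have /andP[h1 h2] := Yb k.+2 (ltnW (ltnW nN)); apply/andP; split => //;
    clear - h1; lra.
have [sh [/andP[sh2 sh3] ysh psh wsh w27]] := yw n nN.
have thY : thirds Y n.+3 by move=> j hj; apply: Y3; apply: leq_trans hj _.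
have sh_gt0 : 0 < sh by apply: lt_le_trans sh2.
have Y2gt0 : 0 < Y n.+2 by apply: lt_le_trans Y2l; clear; lra.
have ysh_gt0 : 0 < y n.+2 * sh by rewrite mulr_gt0.
have ysh0 := ltW ysh_gt0.
have Ysh0 : 0 <= Y n.+2 * sh by rewrite mulr_ge0 // ltW.
have Ysh1 : Y n.+2 * sh <= 1.
  have : Y n.+2 * sh <= 63/200 * 3 by rewrite ler_pM // ltW.
  by move=> h; apply: le_trans h _; clear; lra.
(* at [sh] the new error is nonnegative: [psi y n.+3] is nonpositive there, and
   [Y n.+2] bounds the hump of index [n.+2] of [Y] *)
have e0 : (psi Y n.+2).[Y n.+2 * sh] <= (psi y n.+2).[y n.+2 * sh].
  rewrite -(ler_pM2l sh_gt0).
  move: psh; rewrite psiS subr_le0; apply: le_trans.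
  rewrite -(ler_pM2l Y2gt0).
  by rewrite mulrA mulr1; apply: Ym => //; apply/andP.
pose D s := (psi Y n.+2).[y n.+2 * s] - (psi Y n.+2).[Y n.+2 * s].
have en0 : 0 <= error y Y n.+1 (y n.+2 * sh).
  have h0 : (0 : R) <= 0 <= 7/20 * (y n.+2 * sh) by rewrite lexx /= mulr_ge0 // divr_ge0.
  have [_ _ /andP[+ _] _] := he 0 (y n.+2 * sh) (introT andP (conj ysh0 ysh)) h0.
  by apply: le_trans; rewrite divr_ge0 // mulr_ge0.
have Dsh : y n.+2 * sh * error y Y n.+1 (y n.+2 * sh) <= D sh.
  by rewrite -subr_ge0 -error_recursion /error subr_ge0.
(* [psi Y n.+2] is decreasing, so [0 <= D sh] prevents [y n.+2 > Y n.+2] *)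
have d0 : 0 <= Y n.+2 - y n.+2.
  rewrite leNgt; apply/negP => dneg.
  have yY : Y n.+2 < y n.+2 by rewrite -subr_lt0.
  have hle : Y n.+2 * sh <= y n.+2 * sh by rewrite ler_wpM2r // ltW.
  have ysh1 : y n.+2 * sh <= 1 by apply: le_trans ysh _; clear; lra.
  have [_ _ /(_ isT) hl] := psi_lip (thirdsS thY) Ysh0 hle ysh1.
  have : 0 <= D sh by apply: le_trans Dsh; rewrite mulr_ge0.
  have : 0 < (y n.+2 * sh - Y n.+2 * sh) / 3.
    by rewrite divr_gt0 // -mulrBl mulr_gt0 // subr_gt0.
  rewrite /D; clear - hl; lra.
set d := Y n.+2 - y n.+2 in d0 *.
pose p := (Y n.+2 + y n.+2) * Y n.+1.
pose A := (Y n.+2 ^+ 2 + Y n.+2 * y n.+2 + y n.+2 ^+ 2) * Y n.+1 ^+ 2 * Y n.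
have yY : 0 <= y n.+2 <= Y n.+2 by apply/andP; split; rewrite ?(ltW ygt0) // -subr_ge0.
have DE s : 0 <= s <= 3 -> s * d * (1 - p * s) <= D s <= s * d * (1 - p * s + A * s ^+ 2).
  by move=> s03; apply: (term_change_bounds thY yY s03).
have [p01 A01 sm bg1 bg2] := expansion_coef_bounds yY (introT andP (conj Y2l Y2u))
  (introT andP (conj Y1l Y1u)) (introT andP (conj Y0l Y0u)) (erefl p) (erefl A).
have stp : error_control (next_error (error y Y n.+1) D (y n.+2)) (y n.+2) d.
  apply: (@next_error_control R (error y Y n.+1) D (y n.+2) (y n.+1) d
    (Y n.+1 - y n.+1) p A sh).
  split=> //.
  - by apply/andP; split => //; apply: le_trans yle _; clear; lra.
  - by apply/andP; split => //; rewrite lerBlDr (le_trans Y1u) // lerDl ltW.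
  - exact/andP.
  - move=> y4; have [A2 p1] := bg1 y4; split => //.
    have [yp4|yp4] := leP (y n.+1) (1/4).
      by right; split => //; exact: w27.
    left; split; [exact: wsh|apply: bg2 => //].
    case: (n) nN d'0 yp4 => [|k] nN d'0 yp4; last by have /andP[] := Yb k.+2 (ltnW nN).
    by exfalso; move: d'0; rewrite Y11 subr_ge0 leNgt yp4.
split => //.
  by apply: error_control_ext stp => s; rewrite [RHS]error_recursion.
move=> yE j; rewrite leq_eqVlt => /orP[/eqP->//|]; rewrite ltnS; apply: eqe.
(* when the gap vanishes so does [D], hence the previous error at [y n.+2 * sh],
   hence the previous gap *)
have d00 : d = 0 by rewrite /d yE subrr.
have := DE sh; rewrite d00 mulr0 !mul0r =>
  /(_ (introT andP (conj (ltW sh_gt0) sh3))) /andP[_ D0].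
have h0 : (0 : R) <= 0 <= 7/20 * (y n.+2 * sh) by rewrite lexx /= mulr_ge0 // divr_ge0.
have [_ _ /andP[+ _] _] := he 0 (y n.+2 * sh) (introT andP (conj ysh0 ysh)) h0.
set e1 := error y Y n.+1 _ in Dsh * => e1_low.
have e10 : e1 <= 0.
  by rewrite -(pmulr_rle0 _ ysh_gt0); apply: le_trans D0.
have h : Y n.+1 - y n.+1 <= 0.
  rewrite -(pmulr_rle0 _ ysh_gt0) -(@pmulr_lle0 _ 3^-1) ?invr_gt0 //.
  exact: le_trans e1_low e10.
by apply/eqP; rewrite eq_sym -subr_eq0 eq_le h d'0.
Qed.

End Compare.

(** * Symmetric functions of the roots *)

Section Roots.
Variable R : realFieldType.
Implicit Types (l : seq R) (y : nat -> R).

(** The first three elementary symmetric functions of a list. *)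
Fixpoint e1 l : R := if l is r :: l' then e1 l' + r else 0.
Fixpoint e2 l : R := if l is r :: l' then e2 l' + r * e1 l' else 0.
Fixpoint e3 l : R := if l is r :: l' then e3 l' + r * e2 l' else 0.

(** The polynomial with constant term 1 whose roots are the inverses of the
    elements of the list. *)
Definition revprod l : {poly R} := \prod_(r <- l) (1 - r *: 'X).

Lemma revprod_cons r l : revprod (r :: l) = revprod l - r *: (revprod l * 'X).
Proof. by rewrite /revprod big_cons mulrBl mul1r -scalerAl ['X * _]mulrC. Qed.

Lemma revprod_coef l : [/\ (revprod l)`_0 = 1, (revprod l)`_1 = - e1 l,
  (revprod l)`_2 = e2 l & (revprod l)`_3 = - e3 l].
Proof.
elim: l => [|r l [h0 h1 h2 h3]]; first by rewrite /revprod big_nil !coefC /= oppr0.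
by rewrite !revprod_cons !coefB !coefZ !coefMX /= h0 h1 h2 h3; split; ring.
Qed.

Lemma e_ge0 l : all (fun r => 0 <= r) l -> [/\ 0 <= e1 l, 0 <= e2 l & 0 <= e3 l].
Proof.
elim: l => [|r l IH] //= /andP[r0 /IH[h1 h2 h3]].
by split; rewrite addr_ge0 // mulr_ge0.
Qed.

(** The power sums of degrees 2 and 3. *)
Let p2 l := e1 l ^+ 2 - 2 * e2 l.
Let p3 l := e1 l ^+ 3 - 3 * (e1 l * e2 l) + 3 * e3 l.

Lemma p2_ge0 l : 0 <= p2 l.
Proof.
rewrite /p2; elim: l => [|r l IH] /=; first by rewrite expr0n mulr0 subrr.
have -> : (e1 l + r) ^+ 2 - 2 * (e2 l + r * e1 l) = (e1 l ^+ 2 - 2 * e2 l) + r ^+ 2 by ring.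
by rewrite addr_ge0 // sqr_ge0.
Qed.

(** The expression is the sum of [r * (r - x) ^+ 2] over the list. *)
Lemma moment_quadratic l x : all (fun r => 0 <= r) l ->
  0 <= p3 l - 2 * x * p2 l + x ^+ 2 * e1 l.
Proof.
rewrite /p3 /p2; elim: l => [|r l IH] /=.
  by rewrite !expr0n /= !mulr0 subrr !mulr0 subr0 !addr0.
move=> /andP[r0 /IH h].
set u := e1 l in h *; set v := e2 l in h *; set w := e3 l in h *.
have -> : (u + r) ^+ 3 - 3 * ((u + r) * (v + r * u)) + 3 * (w + r * v) -
  2 * x * ((u + r) ^+ 2 - 2 * (v + r * u)) + x ^+ 2 * (u + r) =
  (u ^+ 3 - 3 * (u * v) + 3 * w - 2 * x * (u ^+ 2 - 2 * v) + x ^+ 2 * u) +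
    r * (r - x) ^+ 2 by ring.
by rewrite addr_ge0 // mulr_ge0 // sqr_ge0.
Qed.

(** Cauchy-Schwarz for the power sums, [p2 ^+ 2 <= e1 * p3]. *)
Lemma e_newton l : all (fun r => 0 <= r) l ->
  4 * e2 l ^+ 2 <= e1 l ^+ 2 * e2 l + 3 * e1 l * e3 l.
Proof.
move=> hl.
have : p2 l ^+ 2 <= e1 l * p3 l.
  elim: l hl => [|x l IH] /=; first
    by rewrite /p2 /p3 /= expr0n /= mulr0 subrr expr0n mul0r.
  move=> /andP[x0 hl].
  have h := IH hl; have hq := mulr_ge0 x0 (moment_quadratic x hl).
  rewrite /p2 /p3 /= in h hq *.
  set u := e1 l in h hq *; set v := e2 l in h hq *; set w := e3 l in h hq *.
  rewrite -subr_ge0 in h; rewrite -subr_ge0.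
  have -> : (u + x) * ((u + x) ^+ 3 - 3 * ((u + x) * (v + x * u)) + 3 * (w + x * v)) -
    ((u + x) ^+ 2 - 2 * (v + x * u)) ^+ 2 =
    (u * (u ^+ 3 - 3 * (u * v) + 3 * w) - (u ^+ 2 - 2 * v) ^+ 2) +
    x * (u ^+ 3 - 3 * (u * v) + 3 * w - 2 * x * (u ^+ 2 - 2 * v) + x ^+ 2 * u) by ring.
  exact: addr_ge0.
rewrite /p2 /p3 => h; rewrite -subr_ge0; rewrite -subr_ge0 in h; move: h.
have -> : e1 l * (e1 l ^+ 3 - 3 * (e1 l * e2 l) + 3 * e3 l) - (e1 l ^+ 2 - 2 * e2 l) ^+ 2 =
  e1 l ^+ 2 * e2 l + 3 * e1 l * e3 l - 4 * e2 l ^+ 2 by ring.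
by [].
Qed.

(** [e1 * e2 - 3 * e3] is the sum of [r * r' * (r + r')] over the pairs. *)
Lemma e_max l u : all (fun r => 0 <= r <= u) l -> e1 l * e2 l <= 3 * e3 l + 2 * u * e2 l.
Proof.
have bnd k : all (fun r => 0 <= r <= u) k -> (0 <= e1 k) /\ (p2 k <= u * e1 k).
  rewrite /p2; elim: k => [|x k IH] /=; first by rewrite expr0n !mulr0 subrr.
  move=> /andP[/andP[x0 xu] /IH[h0 h]]; split; first by rewrite addr_ge0.
  have : x ^+ 2 <= u * x by rewrite expr2 ler_wpM2r.
  by lra.
move=> hl.
elim: l hl => [|x l IH] /=; first by rewrite !mulr0 addr0.
move=> /andP[/andP[x0 xu] hl]; have [hu0 hsq] := bnd l hl.
have h := IH hl.
rewrite /p2 in hsq.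
have h1 : 0 <= x * ((u * e1 l - (e1 l ^+ 2 - 2 * e2 l)) + (u - x) * e1 l).
  by rewrite mulr_ge0 // addr_ge0 ?subr_ge0 // mulr_ge0 // subr_ge0.
nra.
Qed.

(** [2 * e2 = 1 - p2], and [p2] is at least [r1 ^+ 2 + r2 ^+ 2]. *)
Lemma e2_two_roots r1 r2 l : e1 [:: r1, r2 & l] = 1 ->
  4 * e2 [:: r1, r2 & l] <= 2 - (r1 + r2) ^+ 2.
Proof.
move=> /= h; have h2 := p2_ge0 l; rewrite /p2 in h2.
have h0 := sqr_ge0 (r1 - r2).
have h3 : e1 l = 1 - r1 - r2 by rewrite -h; ring.
rewrite h3 in h2 *; nra.
Qed.

Lemma coef_comp_scale (p : {poly R}) (c : R) k : (p \Po (c *: 'X))`_k = p`_k * c ^+ k.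
Proof.
rewrite comp_polyE coef_sum.
under eq_bigr => i _ do rewrite exprZn !coefZ coefXn.
have [kp|kp] := ltnP k (size p).
  rewrite (bigD1 (Ordinal kp)) //= eqxx mulr1 big1 ?addr0 // => i ik.
  by rewrite [k == i]eq_sym (_ : (i == k :> nat) = false) ?mulr0 //;
    apply: contraNF ik => /eqP ik; apply/eqP/val_inj.
rewrite big1 => [|i _]; first by rewrite nth_default // mul0r.
by rewrite gtn_eqF ?mulr0 // (leq_trans (ltn_ord i)).
Qed.

Lemma psi_coefS y n k : (psi y n.+1)`_k.+1 = - ((psi y n)`_k * y n ^+ k).
Proof. by rewrite /= coefB coefC /= sub0r coefXM /= coef_comp_scale. Qed.

Lemma psi_coef0 y n : (psi y n)`_0 = 1.
Proof. by case: n => [|n] /=; rewrite ?coefC //= coefB coefC coefXM /= subr0. Qed.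

Lemma psi_low_coefs y n : y 0%N = 0 ->
  [/\ (psi y n.+2)`_1 = -1, (psi y n.+2)`_2 = y n.+1 &
    (psi y n.+2)`_3 = - (y n.+1 ^+ 2 * y n)].
Proof.
move=> y0; split.
- by rewrite psi_coefS psi_coef0 expr0 mulr1.
- by rewrite !psi_coefS psi_coef0 expr0 expr1 mulr1 mulN1r opprK.
rewrite 2!psi_coefS; case: n => [|n]; first
  by rewrite y0 /= coefC /= !mul0r mulr0 oppr0 mul0r ?oppr0.
by rewrite psi_coefS psi_coef0 expr0 expr1 mulr1 mulN1r opprK mulrC.
Qed.

End Roots.

(** * Constraints on the last quotient *)

Section Window.
Variable R : realFieldType.
Implicit Types (l : seq R) (y : nat -> R).

Lemma revprod_horner l s : (revprod l).[s] = \prod_(r <- l) (1 - r * s).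
Proof. by rewrite horner_prod; apply: eq_bigr => r _; rewrite !hornerE. Qed.

(** If [r1 >= r2] are the two largest elements, the polynomial is nonpositive
    between its two smallest roots [1 / r1] and [1 / r2]. *)
Lemma revprod_le0 r1 r2 l (s : R) : 0 < r2 <= r1 -> all (fun r : R => 0 <= r <= r2) l ->
  1 <= r1 * s -> r2 * s <= 1 -> (revprod [:: r1, r2 & l]).[s] <= 0.
Proof.
move=> /andP[r20 r21] hl h1 h2.
have s0 : 0 <= s by rewrite -(@pmulr_rge0 _ r1) ?(lt_le_trans r20) // (le_trans _ h1).
rewrite revprod_horner !big_cons mulrA mulr_le0_ge0 //.
  by rewrite mulr_le0_ge0 // ?subr_le0 ?subr_ge0.
elim: l hl => [|r l IH] /=; first by rewrite big_nil.
move=> /andP[/andP[r0 rr2] hl]; rewrite big_cons mulr_ge0 ?IH // subr_ge0.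
by apply: le_trans h2; rewrite ler_wpM2r.
Qed.

Lemma psi2_expand y n (s : R) : (psi y n.+2).[s] =
  1 - s + y n.+1 * s ^+ 2 * (psi y n).[y n * (y n.+1 * s)].
Proof. by rewrite !psiS; ring. Qed.

Lemma psi_upper y n (x : R) : thirds y n.+1 -> 0 <= x <= 1 -> (0 < n)%N ->
  (psi y n).[y n * x] <= 1 - y n * x + (y n * x) ^+ 2 / 3.
Proof.
case: n => // n hy /andP[x0 x1] _.
have /andP[a0 a1] := hy n.+1 (ltnSn _).
have /andP[b0 b1] := hy n (leqnSn _).
have w0 : 0 <= y n.+1 * x by rewrite mulr_ge0.
have w1 : y n.+1 * x <= 1/3 by apply: le_trans (_ : 1/3 * 1 <= _);
  [rewrite ler_pM|rewrite mulr1].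
set w := y n.+1 * x in w0 w1 *.
have bw : 0 <= y n * w <= 1 by apply/andP; split;
  [rewrite mulr_ge0|clear -b0 b1 w0 w1; nra].
have /andP[h _] := psi_range (thirdsS (thirdsS hy)) bw.
have h2 : w * (1 - y n * w) <= w * (psi y n).[y n * w] by rewrite ler_wpM2l.
have h3 : w * (y n * w) <= w * (1/3 * w) by rewrite ler_wpM2l // ler_wpM2r.
rewrite psiS; clear -h2 h3; lra.
Qed.

(** The quartic has its maximum on the interval near [73/100]. *)
Lemma quartic_bound (s : R) : 0 <= s <= 3/4 ->
  s - s ^+ 2 + 3156/10000 * s ^+ 3 - 273/10000 * s ^+ 4 <= 63/200.
Proof.
move=> /andP[s0 s1].
have h : 0 <= (s - 73/100) ^+ 2 * (1 + (s * (3/4 - s))).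
  by rewrite mulr_ge0 ?sqr_ge0 //; nra.
have h2 : 0 <= (s - 73/100) ^+ 2 * (3/4 - s) by rewrite mulr_ge0 ?sqr_ge0 //; lra.
have h3 : 0 <= (s - 73/100) ^+ 2 * s ^+ 2 by rewrite mulr_ge0 ?sqr_ge0.
have h4 : 0 <= (s - 73/100) ^+ 2 by rewrite sqr_ge0.
nra.
Qed.

(** What is known of the terms up to [y_(n+1)] when [y_(n+2)] is studied. *)
Definition window_data y n := [/\ y 0%N = 0, y 1%N <= 1/4,
  forall j, (0 < j <= n.+1)%N -> 0 < y j <= 63/200 & y n.+1 * (4 - 3 * y n) <= 1].

(** The value of [psi y n] in the two-step recursion [psi2_expand]. *)
Definition psi_inner y n (s : R) : R := (psi y n).[y n * (y n.+1 * s)].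

Lemma window_thirds y n (W : window_data y n) : thirds y n.+2.
Proof.
have [y0 y1 yb yW] := W.
move=> [|j] hj; first by rewrite y0 lexx divr_ge0.
by have /andP[h1 h2] := @yb j.+1 hj; apply/andP; split; [exact: ltW|clear -h2; lra].
Qed.

Lemma window_top_bounds y n (W : window_data y n) : 0 < y n.+1 <= 63/200.
Proof.
have [y0 y1 yb yW] := W.
by apply: yb; rewrite /= leqnn.
Qed.

Lemma window_prev_bounds y n (W : window_data y n) : 0 <= y n <= 63/200.
Proof.
have [y0 y1 yb yW] := W.
case: (n) yb => [|m] h; first by rewrite y0 lexx divr_ge0.
by have /andP[h1 h2] := h m.+1 (leqnSn _); rewrite ltW.
Qed.

Lemma psi_inner_range y n (W : window_data y n) (s : R) :
  0 <= s <= 1 -> 1 - y n * y n.+1 * s <= psi_inner y n s <= 1.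
Proof.
have [y0 y1 yb yW] := W.
move=> /andP[s0 s1]; have /andP[P0 P1] := (window_top_bounds W);
  have /andP[Q0 Q1] := (window_prev_bounds W).
have h0 : 0 <= y n * (y n.+1 * s) by rewrite !mulr_ge0 // ltW.
have h1 : y n * (y n.+1 * s) <= 1.
  have hPs : y n.+1 * s <= 1 by clear -P0 P1 s0 s1; nra.
  have : 0 <= y n.+1 * s by rewrite mulr_ge0 // ltW.
  by clear -hPs Q0 Q1; nra.
rewrite -mulrA; apply: psi_range; last exact/andP.
exact: thirdsS (thirdsS (window_thirds W)).
Qed.

Lemma psi_inner_anti y n (W : window_data y n) (s t : R) :
  0 <= s -> s <= t -> t <= 1 -> psi_inner y n t <= psi_inner y n s.
Proof.
have [y0 y1 yb yW] := W.
move=> s0 st t1; have /andP[P0 P1] := (window_top_bounds W);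
  have /andP[Q0 Q1] := (window_prev_bounds W).
have h0 : 0 <= y n * (y n.+1 * s) by rewrite !mulr_ge0 // ltW.
have h1 : y n * (y n.+1 * s) <= y n * (y n.+1 * t) by rewrite !ler_wpM2l // ltW.
have h2 : y n * (y n.+1 * t) <= 1.
  have hPs : y n.+1 * t <= 1 by clear -P0 P1 s0 st t1; nra.
  have : 0 <= y n.+1 * t by rewrite mulr_ge0 ?(le_trans s0 st) // ltW.
  by clear -hPs Q0 Q1; nra.
have [h _ _] := psi_lip (thirdsS (thirdsS (window_thirds W))) h0 h1 h2.
by rewrite -subr_ge0.
Qed.

(** The slope comes from the last clause of [window_data], which bounds [y_n]
    from below by [(4 * y_(n+1) - 1) / (3 * y_(n+1))]. *)
Lemma psi_inner_upper y n (W : window_data y n) (s : R) :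
  0 <= s <= 3/4 ->
  y n.+1 * psi_inner y n s <= y n.+1 - s * (y n.+1 * (4 * y n.+1 - 1) / 3) + 6/10000.
Proof.
have [y0 y1 yb yW] := W.
move=> /andP[s0 s1]; have /andP[P0 P1] := (window_top_bounds W);
  have /andP[Q0 Q1] := (window_prev_bounds W).
have s11 : s <= 1 by clear -s1; lra.
have /andP[_ t1] := psi_inner_range W (introT andP (conj s0 s11)).
have [n0|n0] := posnP n.
  have P4 : y n.+1 <= 1/4 by rewrite n0.
  have h : y n.+1 * psi_inner y n s <= y n.+1 by rewrite -[leRHS]mulr1 ler_wpM2l // ltW.
  have h2 : 0 <= s * (y n.+1 * (1 - 4 * y n.+1)).
    by rewrite !mulr_ge0 ?(ltW P0) //; clear -P4; lra.
  by clear -h h2; lra.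
have Ps1 : y n.+1 * s <= 1 by clear -P0 P1 s0 s1; nra.
have Ps0 : 0 <= y n.+1 * s by rewrite mulr_ge0 // ltW.
have := psi_upper (thirdsS (window_thirds W)) (introT andP (conj Ps0 Ps1)) n0.
rewrite -/(psi_inner y n s) => h.
have h1 : y n.+1 * psi_inner y n s <= y n.+1 * (1 - y n * (y n.+1 * s) +
  (y n * (y n.+1 * s)) ^+ 2 / 3) by rewrite ler_wpM2l // ltW.
have w0 : 0 <= y n * (y n.+1 * s) by rewrite mulr_ge0.
have w1 : y n * (y n.+1 * s) <= 149/2000.
  have a : y n.+1 * s <= 63/200 * (3/4) by rewrite ler_pM // ltW.
  have : y n * (y n.+1 * s) <= 63/200 * (63/200 * (3/4)) by rewrite ler_pM.
  by move/le_trans; apply; clear; lra.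
have h2 : y n.+1 * ((y n * (y n.+1 * s)) ^+ 2 / 3) <= 6/10000.
  have a : (y n * (y n.+1 * s)) ^+ 2 <= (149/2000) ^+ 2
    by rewrite lerXn2r // nnegrE; clear; lra.
  have a0 : 0 <= (y n * (y n.+1 * s)) ^+ 2 by rewrite sqr_ge0.
  by clear -a a0 P0 P1; nra.
have h3 : 0 <= y n.+1 * s * (1/3 - y n.+1 * (4 - 3 * y n) / 3).
  by rewrite mulr_ge0 //; move: yW; clear; lra.
clear -h1 h2 h3; nra.
Qed.

Lemma hump_expand y n (s : R) :
  s * (psi y n.+2).[s] = s - s ^+ 2 + s ^+ 3 * (y n.+1 * psi_inner y n s).
Proof. by rewrite psi2_expand /psi_inner; ring. Qed.

Lemma hump_upper y n (W : window_data y n) (s : R) :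
  0 <= s <= 3/4 -> s * (psi y n.+2).[s] <= 63/200.
Proof.
have [y0 y1 yb yW] := W.
move=> s01; have h := psi_inner_upper W s01; have hp := quartic_bound s01.
rewrite hump_expand; case/andP: s01 => s0 s1; have /andP[P0 P1] := (window_top_bounds W).
have h1 : y n.+1 - s * (y n.+1 * (4 * y n.+1 - 1) / 3) <= 63/200 - 273/10000 * s.
  have : 0 <= (63/200 - y n.+1) * (1 - s * (4 * (63/200 + y n.+1) - 1) / 3).
    rewrite mulr_ge0 //; first by rewrite subr_ge0.
    by clear -s0 s1 P0 P1; nra.
  by clear; nra.
have h2 : s ^+ 3 * (y n.+1 * psi_inner y n s) <= s ^+ 3 * (3156/10000 - 273/10000 * s).
  by rewrite ler_wpM2l ?exprn_ge0 //; clear -h h1; lra.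
by apply: le_trans hp; clear -h2; lra.
Qed.

(** Beyond [3/4] the hump [s * psi_(n+2)(s)] stays below its value at [3/4]. *)
Lemma hump_decr y n (W : window_data y n) (s : R) :
  3/4 <= s <= 1 -> s * (psi y n.+2).[s] <= 3/4 * (psi y n.+2).[3/4].
Proof.
have [y0 y1 yb yW] := W.
move=> /andP[s0 s1]; have /andP[P0 P1] := (window_top_bounds W).
have c34 : (0 : R) <= 3/4 <= (3/4 : R) by rewrite lexx andbT divr_ge0.
have c30 : (0 : R) <= 3/4 by clear; lra.
have hc := psi_inner_upper W c34.
have ht : y n.+1 * psi_inner y n s <= y n.+1 * psi_inner y n (3/4)
  by rewrite ler_wpM2l ?(ltW P0) // (psi_inner_anti W).
have hc2 : y n.+1 * psi_inner y n (3/4) <= 8/27 by clear -hc P0 P1; nra.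
rewrite !hump_expand.
have h1 : s ^+ 3 * (y n.+1 * psi_inner y n s) <= s ^+ 3 * (y n.+1 * psi_inner y n (3/4)).
  by rewrite ler_wpM2l // exprn_ge0 // (le_trans c30).
set c := y n.+1 * psi_inner y n (3/4) in h1 hc2 *.
have h2 : 0 <= (s - 3/4) * - (1/4 - s + c * (s ^+ 2 + 3/4 * s + 9/16)).
  rewrite mulr_ge0 //; first by rewrite subr_ge0.
  rewrite oppr_ge0.
  have : c * (s ^+ 2 + 3/4 * s + 9/16) <= 8/27 * (s ^+ 2 + 3/4 * s + 9/16).
    by rewrite ler_wpM2r //; clear -s0; nra.
  by clear -s0 s1; nra.
by clear -h1 h2; nra.
Qed.

Lemma hump_small y n (W : window_data y n) (s : R) :
  y n.+1 <= 1/4 -> 0 <= s <= 1 -> s * (psi y n.+2).[s] <= 8/27.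
Proof.
have [y0 y1 yb yW] := W.
move=> P4 s01; have /andP[_ t1] := psi_inner_range W s01; case/andP: s01 => s0 s1.
have /andP[P0 P1] := (window_top_bounds W).
rewrite hump_expand.
have h1 : y n.+1 * psi_inner y n s <= 1/4 * 1.
  by apply: le_trans (_ : y n.+1 * 1 <= _); [rewrite ler_wpM2l // ltW|rewrite !mulr1].
have h2 : s ^+ 3 * (y n.+1 * psi_inner y n s) <= s ^+ 3 * (1/4 * 1)
  by rewrite ler_wpM2l // exprn_ge0.
have h3 : 0 <= (s - 2/3) ^+ 2 * (8/3 - s) by rewrite mulr_ge0 ?sqr_ge0 //; clear -s1; lra.
by clear -h2 h3; nra.
Qed.

Lemma hump_direct y n (W : window_data y n) (x : R) :
  1/4 < y n.+1 -> 0 <= x <= 121/200 -> 7/15 <= (psi y n.+2).[x].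
Proof.
have [y0 y1 yb yW] := W.
move=> P4 /andP[x0 x1].
have x11 : x <= 1 by clear -x1; lra.
have /andP[t0 _] := psi_inner_range W (introT andP (conj x0 x11)).
have /andP[P0 P1] := (window_top_bounds W); have /andP[Q0 Q1] := (window_prev_bounds W).
have QP : y n * y n.+1 <= 1/10.
  have : y n * y n.+1 <= 63/200 * (63/200) by rewrite ler_pM // ltW.
  by move/le_trans; apply; clear; lra.
have QPx : y n * y n.+1 * x <= 121/2000.
  have : y n * y n.+1 * x <= 1/10 * (121/200) by rewrite ler_pM // mulr_ge0 // ltW.
  by move/le_trans; apply; clear; lra.
have th0 : 1879/2000 <= psi_inner y n x by clear -QPx t0; lra.
have h1 : 1/4 * (1879/2000) <= y n.+1 * psi_inner y n x
  by rewrite ler_pM //; [clear; lra|clear; lra|exact: ltW].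
have h2 : x ^+ 2 * (1/4 * (1879/2000)) <= x ^+ 2 * (y n.+1 * psi_inner y n x)
  by rewrite ler_wpM2l // sqr_ge0.
rewrite psi2_expand.
have -> : 1 - x + y n.+1 * x ^+ 2 * psi_inner y n x =
  1 - x + x ^+ 2 * (y n.+1 * psi_inner y n x) by ring.
by clear -h2 x0 x1; nra.
Qed.

(** The factorization of [psi_(n+3)], with [r1] and [r2] the two largest
    reciprocal roots. *)
Definition root_data y n (r1 r2 : R) l :=
  [/\ 0 < r2, r2 <= r1, all (fun r : R => 0 <= r <= r2) l,
      psi y n.+3 = revprod [:: r1, r2 & l] & 0 < y n.+2].

Lemma root_data_sums y n (r1 r2 : R) l
  (W : window_data y n) (H : root_data y n r1 r2 l) :
  [/\ e1 [:: r1, r2 & l] = 1, e2 [:: r1, r2 & l] = y n.+2 &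
    e3 [:: r1, r2 & l] = y n.+2 ^+ 2 * y n.+1].
Proof.
have [y0 y1 yb yW] := W; have [r2_gt0 r21 lr psiE Y0] := H.
have [h1 h2 h3] := psi_low_coefs n.+1 y0; have [_ g1 g2 g3] := revprod_coef [:: r1, r2 & l].
rewrite -psiE in g1 g2 g3; split.
- by apply: oppr_inj; rewrite -g1.
- by rewrite -g2.
- by apply: oppr_inj; rewrite -g3.
Qed.

Lemma root_data_ge0 y n (r1 r2 : R) l
  (W : window_data y n) (H : root_data y n r1 r2 l) :
  all (fun r : R => 0 <= r) [:: r1, r2 & l].
Proof.
have [y0 y1 yb yW] := W; have [r2_gt0 r21 lr psiE Y0] := H.
rewrite /= (ltW r2_gt0) (le_trans (ltW r2_gt0) r21) /=.
by apply: sub_all lr => r /andP[].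
Qed.

Lemma last_quotient_newton y n (r1 r2 : R) l
  (W : window_data y n) (H : root_data y n r1 r2 l) :
  y n.+2 * (4 - 3 * y n.+1) <= 1.
Proof.
have [y0 y1 yb yW] := W; have [r2_gt0 r21 lr psiE Y0] := H.
have [E1 E2 E3] := (root_data_sums W H); have := e_newton (root_data_ge0 W H);
  rewrite E1 E2 E3 => h.
rewrite -(ler_pM2l Y0); move: h; clear; nra.
Qed.

Lemma last_quotient_third y n (r1 r2 : R) l
  (W : window_data y n) (H : root_data y n r1 r2 l) :
  y n.+2 <= 1/3.
Proof.
have [r2_gt0 r21 lr psiE Y0] := H.
by have := (last_quotient_newton W H); have /andP[P0 P1] := (window_top_bounds W);
  have : 0 < y n.+2 := Y0; clear -P0 P1; nra.
Qed.

Lemma top_root_lower y n (r1 r2 : R) l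
  (W : window_data y n) (H : root_data y n r1 r2 l) :
  17/50 <= r1.
Proof.
have [y0 y1 yb yW] := W; have [r2_gt0 r21 lr psiE Y0] := H.
have [E1 E2 E3] := (root_data_sums W H).
have hl : all (fun r : R => 0 <= r <= r1) [:: r1, r2 & l].
  rewrite /= (ltW r2_gt0) (le_trans (ltW r2_gt0) r21) lexx r21 /=.
  by apply: sub_all lr => r /andP[-> /le_trans->].
have := e_max hl; rewrite E1 E2 E3 => h.
have h2 : 1 <= 3 * y n.+2 * y n.+1 + 2 * r1 by rewrite -(ler_pM2l Y0); move: h; clear; lra.
have YP : y n.+2 * y n.+1 <= 1/3 * (63/200).
  by have /andP[P0 P1] := (window_top_bounds W);
    rewrite ler_pM ?(last_quotient_third W H) // ltW.
by move: h2 YP; clear; lra.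
Qed.

Lemma second_root_upper y n (r1 r2 : R) l
  (W : window_data y n) (H : root_data y n r1 r2 l) :
  r2 <= 1/2 /\ (2823/10000 <= y n.+2 -> r2 <= 7/15).
Proof.
have [y0 y1 yb yW] := W; have [r2_gt0 r21 lr psiE Y0] := H.
have [E1 E2 E3] := (root_data_sums W H); have := e2_two_roots E1; rewrite E2 => h.
have [h0 _ _] : [/\ 0 <= e1 l, 0 <= e2 l & 0 <= e3 l].
  by apply: e_ge0; apply: sub_all lr => r /andP[].
split; first by move: E1; rewrite /= => E1'; clear -E1' h0 r21; lra.
move=> hY; rewrite leNgt; apply/negP => hr.
have : (14/15) ^+ 2 <= (r1 + r2) ^+ 2 by rewrite lerXn2r // ?nnegrE //; clear -hr r21; lra.
by move: h hY; clear; lra.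
Qed.

(** By [revprod_le0] the polynomial [psi_(n+3)] is nonpositive from [1 / r1 <= 3]
    to [1 / r2 >= 2]; the work is to find a point there where moreover
    [y_(n+2) * sh <= 3/4]. *)
Lemma window_exists y n (r1 r2 : R) l
  (W : window_data y n) (H : root_data y n r1 r2 l) :
  exists sh : R, [/\ 2 <= sh <= 3, y n.+2 * sh <= 3/4, (psi y n.+3).[sh] <= 0 &
            1/4 < y n.+2 -> 1/4 < y n.+1 -> 15/7 <= sh].
Proof.
have [y0 y1 yb yW] := W; have [r2_gt0 r21 lr psiE Y0] := H.
have Ygt : 0 < y n.+2 := Y0; have Y3 := (last_quotient_third W H);
  have r1l := (top_root_lower W H).
have [r2h r2s] := (second_root_upper W H).
have r1_gt0 : 0 < r1 by apply: lt_le_trans r21.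
(* a point [t] where psi is nonpositive but [y n.+2 * t > 3/4] can be replaced by
   [3/4 / y n.+2], because the hump is larger at [3/4] than at [y n.+2 * t] *)
have red (t u : R) : 2 <= u -> u <= t -> t <= 3 -> (psi y n.+3).[t] <= 0 ->
    (1/4 < y n.+2 -> 1/4 < y n.+1 -> 15/7 <= t) ->
    exists sh : R, [/\ 2 <= sh <= 3, y n.+2 * sh <= 3/4, (psi y n.+3).[sh] <= 0 &
            1/4 < y n.+2 -> 1/4 < y n.+1 -> 15/7 <= sh].
  move=> u2 ut t3 pt t157; have t2 := le_trans u2 ut.
  have [Yt|Yt] := leP (y n.+2 * t) (3/4); first by exists t; split => //; exact/andP.
  have Yt1 : y n.+2 * t <= 1.
    have : y n.+2 * t <= 1/3 * 3
      by rewrite ler_pM // ?ltW //; apply: lt_le_trans t2; clear; lra.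
    by move/le_trans; apply; clear; lra.
  have hd := hump_decr W (introT andP (conj (ltW Yt) Yt1)).
  have hy : y n.+2 <= 3/4 * (psi y n.+2).[3/4].
    apply: le_trans hd; move: pt; rewrite psiS subr_le0 -mulrA => h.
    by rewrite -[leLHS]mulr1 ler_wpM2l // ltW.
  pose sh := 3/4 / y n.+2.
  have YshE : y n.+2 * sh = 3/4 by rewrite /sh mulrCA divff ?mulr1 // gt_eqF.
  have shl : 9/4 <= sh by rewrite /sh ler_pdivlMr //; clear -Y3; lra.
  have sht : sh <= t by rewrite -(ler_pM2l Ygt) YshE ltW.
  exists sh; split.
  - by apply/andP; split; [clear -shl; lra|exact: le_trans t3].
  - by rewrite YshE.
  - rewrite psiS YshE subr_le0 -(ler_pM2l Ygt) mulr1 mulrA YshE; exact: hy.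
  - by move=> _ _; clear -shl; lra.
have inv1 : r1^-1 <= 3.
  by rewrite -[leLHS]mul1r ler_pdivrMr //; clear -r1l; lra.
(* the larger of [sL] and [1 / r1] lies between [1 / r1] and [1 / r2] *)
have app (sL : R) : 2 <= sL -> sL <= 3 -> r2 * sL <= 1 ->
    (1/4 < y n.+2 -> 1/4 < y n.+1 -> 15/7 <= sL) ->
    exists sh : R, [/\ 2 <= sh <= 3, y n.+2 * sh <= 3/4, (psi y n.+3).[sh] <= 0 &
            1/4 < y n.+2 -> 1/4 < y n.+1 -> 15/7 <= sh].
  move=> sL2 sL3 rsL sLw.
  pose t := Num.max sL r1^-1.
  have sLt : sL <= t by rewrite /t le_max lexx.
  have r1t : r1^-1 <= t by rewrite /t le_max lexx orbT.
  apply: (red t sL) => //.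
  - by rewrite /t ge_max sL3.
  - rewrite psiE; apply: revprod_le0 => //; first by rewrite r2_gt0.
      by rewrite -ler_pdivrMl // mulr1.
    rewrite /t; case: (leP sL r1^-1) => // _.
    by rewrite ler_pdivrMr ?mul1r.
  - by move=> a b; apply: le_trans sLt; apply: sLw.
(* from [2823/10000] on, [second_root_upper] gives [1 / r2 >= 15/7] *)
have [Ys|Yb] := ltP (y n.+2) (2823/10000); last first.
  apply: (app (15/7)); [clear; lra|clear; lra| |by []].
  by have := r2s Yb; clear; lra.
have [P4|] := boolP (y n.+1 <= 1/4); last rewrite -ltNge => P4.
  apply: (app 2); [clear; lra|clear; lra|by move: r2h; clear; lra|].
  by move=> _; rewrite ltNge P4.
apply: (red (15/7) 2); [clear; lra|clear; lra|clear; lra| |by []].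
have hx : 0 <= y n.+2 * (15/7) <= 121/200.
  by apply/andP; split; [rewrite mulr_ge0 ?divr_ge0 // ltW|clear -Ys; lra].
rewrite psiS subr_le0.
apply: le_trans (_ : 15/7 * (7/15) <= _); first by clear; lra.
by apply: ler_wpM2l; [rewrite divr_ge0|exact: hump_direct hx].
Qed.

Lemma last_quotient_bounds y n (r1 r2 : R) l
  (W : window_data y n) (H : root_data y n r1 r2 l) :
  [/\ y n.+2 <= 63/200, y n.+2 * (4 - 3 * y n.+1) <= 1, y n.+1 <= 1/4 -> y n.+2 <= 8/27 &
  exists sh : R, [/\ 2 <= sh <= 3, y n.+2 * sh <= 3/4, (psi y n.+3).[sh] <= 0 &
            1/4 < y n.+2 -> 1/4 < y n.+1 -> 15/7 <= sh]].
Proof.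
have [y0 y1 yb yW] := W; have [r2_gt0 r21 lr psiE Y0] := H.
have [sh [/andP[sh2 sh3] Ysh psh hw]] := (window_exists W H).
have Ygt : 0 < y n.+2 := Y0.
have sh0 : 0 <= sh by apply: le_trans sh2.
have Ysh0 : 0 <= y n.+2 * sh by rewrite mulr_ge0 // ltW.
have hy : y n.+2 <= y n.+2 * sh * (psi y n.+2).[y n.+2 * sh].
  move: psh; rewrite psiS subr_le0 -mulrA => h.
  by rewrite -[leLHS]mulr1 ler_wpM2l // ltW.
split.
- by apply: le_trans hy _; apply: (hump_upper W); exact/andP.
- exact: (last_quotient_newton W H).
- move=> P4; apply: le_trans hy _; apply: (hump_small W) => //.
  by apply/andP; split => //; clear -Ysh; lra.
- by exists sh; split => //; exact/andP.
Qed.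

End Window.

(** * Sections of a sequence *)

Section Sections.
Variable R : realType.
Implicit Types (a : nat -> R) (n : nat) (p q : {poly R}).

(** The section of degree [n], as a polynomial. *)
Definition section a n : {poly R} := \poly_(i < n.+1) a i.

(** The reciprocal [a_(n-1) a_(n+1) / a_n ^ 2] of the coefficient quotient; the
    value 0 at index 0 amounts to [a_(-1) = 0]. *)
Definition inv_quotient a n : R := if n is k.+1 then a k * a k.+2 / a k.+1 ^+ 2 else 0.

Lemma section_recS a n : section a n.+1 = section a n + a n.+1 *: 'X^(n.+1).
Proof. by rewrite /section !poly_def big_ord_recr. Qed.

Lemma section_psi a n (t : R) : (forall i, (i <= n)%N -> 0 < a i) -> 0 < t ->
  (section a n).[- t] =
    (-1) ^+ n * (a n * t ^+ n) * (psi (inv_quotient a) n).[a n.-1 / (a n * t)].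
Proof.
move=> apos t0; have tn0 : t != 0 by rewrite gt_eqF.
elim: n apos => [|n IH] apos.
  by rewrite psi0 /section poly_def big_ord1 expr0 !hornerE.
have an i : (i <= n.+1)%N -> a i != 0 by move=> h; rewrite gt_eqF ?apos.
rewrite section_recS hornerD hornerZ hornerXn IH => [|i hi]; last by rewrite apos // ltnW.
rewrite psiS.
have -> : (- t) ^+ n.+1 = (-1) ^+ n.+1 * t ^+ n.+1 by rewrite -exprMn mulN1r.
rewrite [(-1) ^+ n.+1]exprS [t ^+ n.+1]exprS.
have -> : (psi (inv_quotient a) n).[inv_quotient a n * (a n.+1.-1 / (a n.+1 * t))] =
   (psi (inv_quotient a) n).[a n.-1 / (a n * t)].
  case: n an {IH apos} => [|n] an; first by rewrite !psi0.
  congr (_.[_]); rewrite /=; field.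
  by rewrite !an // tn0.
rewrite /=; field.
by rewrite !an // tn0.
Qed.

Lemma poly_eq_pos p q : (forall s : R, 0 < s -> p.[s] = q.[s]) -> p = q.
Proof.
move=> h; apply/eqP; rewrite -subr_eq0; apply/eqP.
pose rs : seq R := [seq i.+1%:R | i <- iota 0 (size (p - q))].
apply: (@roots_geq_poly_eq0 _ _ rs); last by rewrite size_map size_iota.
  by apply/allP => _ /mapP[i _ ->]; rewrite /root hornerD hornerN h ?subrr.
rewrite map_inj_uniq ?iota_uniq // => i j /eqP.
by rewrite eqr_nat eqSS => /eqP.
Qed.

Lemma hyperbolic_split q : hyperbolic q ->
  exists l : seq R, q = lead_coef q *: \prod_(x <- l) ('X - x%:P).
Proof.
move=> hq; have [rs E] := closed_field_poly_normal (map_poly (real_complex R) q).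
have [->|q0] := eqVneq q 0; first by exists [::]; rewrite lead_coef0 scale0r.
exists [seq complex.Re z | z <- rs].
apply: (map_poly_inj (real_complex R)); rewrite {1}E linearZ /= lead_coef_map;
  congr (_ *: _).
rewrite rmorph_prod big_map; apply: eq_big_seq => z zrs.
rewrite rmorphB /= map_polyX map_polyC /=; congr (_ - _%:P).
have : root (map_poly (real_complex R) q) z.
  by rewrite E rootZ ?lead_coef_eq0 ?map_poly_eq0 // root_prod_XsubC.
by move/hq; case: z {zrs} => x y /= ->.
Qed.

Lemma section_size a n : a n != 0 -> size (section a n) = n.+1.
Proof. by move=> an; rewrite /section size_poly_eq. Qed.

Lemma section_lead a n : a n != 0 -> lead_coef (section a n) = a n.
Proof. by move=> an; rewrite lead_coefE section_size // coef_poly ltnSn. Qed.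

Lemma section_pos a n (x : R) : (forall i, (i <= n)%N -> 0 < a i) -> 0 <= x ->
  0 < (section a n).[x].
Proof.
move=> apos x0; elim: n apos => [|n IH] apos.
  by rewrite /section poly_def big_ord1 expr0 !hornerE apos.
rewrite section_recS hornerD hornerZ hornerXn ltr_wpDr //.
  by rewrite mulr_ge0 ?exprn_ge0 // ltW // apos.
by apply: IH => i hi; rewrite apos // ltnW.
Qed.

(** A hyperbolic section with positive coefficients has negative roots only, so
    [psi] splits into factors [1 - r X] with [r > 0]. *)
Lemma psi_revprod a n : (forall i, (i <= n)%N -> 0 < a i) -> hyperbolic (section a n) ->
  exists l : seq R, [/\ size l = n, all (fun r : R => 0 < r) l, sorted >=%R l &
    psi (inv_quotient a) n = revprod l].
Proof.
move=> apos hyp; have [l E] := hyperbolic_split hyp.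
have an0 : a n != 0 by rewrite gt_eqF ?apos.
rewrite section_lead // in E.
have lpos : all (fun x => x < 0) l.
  apply/allP => x xl; rewrite ltNge; apply/negP => x0.
  have := section_pos apos x0; rewrite E hornerZ.
  have /eqP-> : (\prod_(z <- l) ('X - z%:P)).[x] == 0
    by rewrite -/(root _ _) root_prod_XsubC.
  by rewrite mulr0 ltxx.
have sl : size l = n.
  apply/eqP; rewrite -eqSS -(size_prod_XsubC l id) -(size_scale _ an0) -E.
  by rewrite section_size.
pose P := a n.-1 / a n.
have P0 : 0 < P by rewrite divr_gt0 ?apos // leq_pred.
have an_gt0 : 0 < a n by apply: apos.
pose l1 := [seq - x / P | x <- l].
pose l2 := sort >=%R l1.
have pl : perm_eq l2 l1 by rewrite perm_sort.
exists l2; split.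
- by rewrite size_sort size_map.
- rewrite (perm_all _ pl) all_map; apply: sub_all lpos => x /= x0.
  by rewrite divr_gt0 // oppr_gt0.
- by apply: sort_sorted => x y; apply: le_total.
- have -> : revprod l2 = revprod l1 by rewrite /revprod (perm_big _ pl).
  apply: poly_eq_pos => s s0.
  pose t := P / s; have t0 : 0 < t by rewrite divr_gt0.
  have := section_psi apos t0.
  have -> : a n.-1 / (a n * t) = s.
    rewrite /t /P; field; rewrite (gt_eqF s0) (gt_eqF an_gt0) /= gt_eqF // apos //.
    exact: leq_pred.
  have -> : (section a n).[- t] = (-1) ^+ n * (a n * t ^+ n) * (revprod l1).[s].
    have HP : (\prod_(x <- l) ('X - x%:P)).[- t] = (-1) ^+ n * t ^+ n * (revprod l1).[s].
      rewrite horner_prod revprod_horner big_map -sl.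
      elim: (l) => [|x k IH]; first by rewrite !big_nil /= !expr0 !mulr1.
      rewrite !big_cons /= !exprS IH hornerXsubC.
      have -> : - t - x = - t * (1 - - x / P * s).
        by rewrite /t; field; rewrite (gt_eqF P0) (gt_eqF s0).
      by ring.
    by rewrite E hornerZ HP; ring.
  move=> H; apply: (@mulfI _ ((-1) ^+ n * (a n * t ^+ n))); last by rewrite -H.
  by rewrite mulf_neq0 ?signr_eq0 // mulf_neq0 // expf_neq0 // gt_eqF.
Qed.

End Sections.

(** * Hyperbolic sections give an admissible sequence *)

Section Necessary.
Variable R : realType.
Implicit Types (a : nat -> R) (n N : nat).

Lemma inv_quotient_gt0 a n : (0 < n)%N -> (forall i, (i <= n.+1)%N -> 0 < a i) ->
  0 < inv_quotient a n.
Proof.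
case: n => // n _ h.
by rewrite /= divr_gt0 ?exprn_gt0 ?mulr_gt0 ?h // ltnW // ltnW.
Qed.

(** [e_newton] for the reciprocal roots, with [e1 = 1], [e2 = y_(n+1)] and
    [e3 = y_(n+1) ^ 2 y_n]. *)
Lemma newton_quotient a n : (forall i, (i <= n.+2)%N -> 0 < a i) ->
  hyperbolic (section a n.+2) ->
  inv_quotient a n.+1 * (4 - 3 * inv_quotient a n) <= 1.
Proof.
move=> apos hyp; have [l [_ lpos _ psiE]] := psi_revprod apos hyp.
have [h1 h2 h3] := psi_low_coefs n (erefl (inv_quotient a 0%N)).
have [_ g1 g2 g3] := revprod_coef l.
rewrite psiE {}g1 {}g2 {}g3 in h1 h2 h3.
have l0 : all (fun r : R => 0 <= r) l by apply: sub_all lpos => r; apply: ltW.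
have := e_newton l0.
have -> : e1 l = 1 by apply: oppr_inj.
have -> : e3 l = inv_quotient a n.+1 ^+ 2 * inv_quotient a n by apply: oppr_inj.
rewrite h2 => h; rewrite -(ler_pM2l (inv_quotient_gt0 (ltn0Sn _) apos)).
set Y := inv_quotient a n.+1 in h *; set P := inv_quotient a n in h *.
by clear -h; lra.
Qed.

Lemma admissible_of_hyperbolic a N : (forall i, (i <= N.+1)%N -> 0 < a i) ->
  (forall m, (0 < m <= N.+1)%N -> hyperbolic (section a m)) ->
    admissible (inv_quotient a) N.
Proof.
move=> apos hyp.
have apos' n : (n <= N.+1)%N -> forall i, (i <= n)%N -> 0 < a i.
  by move=> nN i hi; apply: apos; apply: leq_trans nN.
have nw n : (n.+1 <= N)%N -> inv_quotient a n.+1 * (4 - 3 * inv_quotient a n) <= 1.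
  by move=> nN; apply: newton_quotient; [exact: apos'|apply: hyp].
have y14 : (0 < N)%N -> inv_quotient a 1 <= 1/4.
  by move=> N0; have := nw 0%N N0; rewrite [inv_quotient a 0]/=; lra.
have rd n : (n.+2 <= N)%N -> exists r1 r2 l, root_data (inv_quotient a) n r1 r2 l.
  move=> nN; have [||l [sl lpos ls psiE]] := @psi_revprod R a n.+3;
    [exact: apos'|exact: hyp|].
  case: l sl lpos ls psiE => [//|r1 [//|r2 l]] _ /= /and3P[r10 r20 lpos] /andP[r21 ls] psiE.
  exists r1, r2, l; split => //; last exact: inv_quotient_gt0 (ltn0Sn _) (apos' _ _).
  have := order_path_min ge_trans ls; move: lpos; clear.
  by elim: l => //= r l IH /andP[r0 hl] /andP[rr hl2]; rewrite ltW //= rr IH.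
have bnd n : (n <= N)%N -> forall j, (0 < j <= n)%N -> 0 < inv_quotient a j <= 63/200.
  elim: n => [|[|n] IH] nN j /andP[j0]; first
    by rewrite leqn0 => /eqP j00; rewrite j00 in j0.
    rewrite leq_eqVlt => /orP[/eqP->|]; last
      by rewrite ltnS leqn0 => /eqP j00; rewrite j00 in j0.
    rewrite inv_quotient_gt0 //; last by apply: apos'.
    by apply: le_trans (y14 nN) _; clear; lra.
  rewrite leq_eqVlt => /orP[/eqP->|]; last
    by rewrite ltnS => jn; apply: IH; rewrite ?j0 // ltnW.
  have [r1 [r2 [l H]]] := rd n nN.
  rewrite inv_quotient_gt0 //; last exact: apos'.
  have W : window_data (inv_quotient a) n.
    split => //; [by apply: y14; apply: leq_trans nN|by apply: IH; apply: ltnW|].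
    by apply: nw; apply: ltnW.
  by have [] := last_quotient_bounds W H.
split => //; first exact: bnd.
move=> n nN; have [r1 [r2 [l H]]] := rd n nN.
have W : window_data (inv_quotient a) n.
  split => //; [by apply: y14; apply: leq_trans nN|by apply: bnd; apply: ltnW|].
  by apply: nw; apply: ltnW.
have [_ _ h27 [sh [h1 h2 h3 h4]]] := last_quotient_bounds W H.
by exists sh; split.
Qed.

(** The point is [y_n * sh], with [sh] the point of the window where the next
    [psi] is nonpositive. *)
Lemma hump_of_admissible (y : nat -> R) n N : admissible y N -> (0 < n <= N)%N ->
  exists2 s : R, 0 <= s <= 1 & y n <= s * (psi y n).[s].
Proof.
case=> y0 y1 yb yw; case: n => [//|[|n]] /andP[_ nN].
  exists (1/2); first by apply/andP; split; clear; lra.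
  by have := y1 nN; rewrite psiS psi0; clear; lra.
have /andP[ygt0 _] := @yb n.+2 nN.
have [sh [/andP[sh2 sh3] Ysh psh _ _]] := yw n nN.
have sh0 : 0 <= sh by apply: le_trans sh2.
exists (y n.+2 * sh).
  by apply/andP; split; [rewrite mulr_ge0 // ltW|clear -Ysh; lra].
move: psh; rewrite psiS subr_le0 -mulrA => h.
by rewrite -[leLHS]mulr1 ler_wpM2l // ltW.
Qed.

End Necessary.

(** * A criterion for hyperbolicity *)

Section Sufficient.
Variable R : realType.
Implicit Types (a : nat -> R) (n N : nat).

(** A real polynomial of degree [d] with [d - 1] distinct real roots is
    hyperbolic. *)
Lemma hyperbolic_of_roots (f : {poly R}) (rs : seq R) :
  size f = (size rs).+2 -> uniq rs -> all (root f) rs -> hyperbolic f.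
Proof.
move=> sf urs rrs; have [|q E] := uniq_roots_prod_XsubC rrs; first by rewrite uniq_rootsE.
have f0 : f != 0 by rewrite -size_poly_eq0 sf.
have q0 : q != 0 by apply: contraNneq f0 => q0; rewrite E q0 mul0r.
have sq : size q = 2%N.
  have := sf; rewrite E size_Mmonic ?monic_prod_XsubC // size_prod_XsubC addnS /= => /eqP.
  by rewrite -[(size rs).+2]add2n eqn_add2r => /eqP.
move=> z; rewrite E rmorphM rootM /= => /orP[].
  have qE : q = (q`_0)%:P + q`_1 *: 'X.
    apply/polyP => -[|[|i]]; rewrite coefD coefC coefZ coefX /= ?mulr0 ?mulr1 ?addr0 ?add0r //.
    by rewrite nth_default // sq.
  have q10 : q`_1 != 0 by have := lead_coef_eq0 q; rewrite lead_coefE sq => ->.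
  rewrite /root qE rmorphD /= map_polyC map_polyZ map_polyX !hornerE.
  case: z => x y; rewrite eq_complex /= => /andP[_].
  by rewrite mul0r addr0 add0r mulf_eq0 (negPf q10) => /eqP.
rewrite rmorph_prod /= => h.
have : root (\prod_(w <- [seq x%:C%C | x <- rs]) ('X - w%:P)) z.
  rewrite big_map; move: h; congr (is_true (root _ z)); apply: eq_bigr => x _.
  by rewrite rmorphB /= map_polyX map_polyC.
by rewrite root_prod_XsubC => /mapP[x _ ->].
Qed.

Lemma hump_third (y : nat -> R) n (s : R) : thirds y n -> (0 < n)%N -> 0 <= s <= 1 ->
  s * (psi y n).[s] <= 1/3.
Proof.
case: n => // n hy _ /andP[s0 s1]; have /andP[y0 y1] := hy n (ltnSn n).
have ys0 : 0 <= y n * s by rewrite mulr_ge0.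
have ys1 : y n * s <= 1/3 * s by rewrite ler_wpM2r.
have h : 0 <= y n * s <= 1 by rewrite ys0 /=; clear -ys1 s1; lra.
have /andP[h1 _] := psi_range (thirdsS hy) h.
rewrite psiS; set t := (psi y n).[_] in h1 *.
have h2 : 1 - 1/3 * s <= t by clear -h1 ys1; lra.
have h3 : s ^+ 2 * (1 - 1/3 * s) <= s ^+ 2 * t by rewrite ler_wpM2l // sqr_ge0.
have h4 : 0 <= (1 - s) ^+ 3 by rewrite exprn_ge0 // subr_ge0.
by clear -h3 h4; lra.
Qed.

(** Each reciprocal quotient of index below [N] is at most a value of the hump
    [s * psi_k(s)] on the unit interval. *)
Definition humps a N := forall k, (0 < k < N)%N ->
  exists2 s : R, 0 < s <= 1 & inv_quotient a k <= s * (psi (inv_quotient a) k).[s].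

Lemma humps_thirds a N : (forall i, (i <= N)%N -> 0 < a i) -> humps a N ->
  thirds (inv_quotient a) N.
Proof.
move=> apos hh j; elim/ltn_ind: j => -[|j] IH jN; first by rewrite /= lexx divr_ge0.
rewrite ltW; last by apply: inv_quotient_gt0 => // i hi; apply: apos;
  apply: leq_trans hi jN.
have [s /andP[s0 s1] h] := hh j.+1 jN.
apply: le_trans h _; apply: hump_third => //; last by rewrite ltW.
by move=> i ij; apply: IH => //; apply: ltn_trans jN.
Qed.

(** At [- t], the terms of index above [k] alternate in sign and decrease in
    size, and the first one has the sign of the section of degree [k]; so adding
    them does not change that sign. *)
Lemma tail_sign a N k (t : R) : (forall i, (i <= N)%N -> 0 < a i) -> (k < N)%N -> 0 < t ->
  (forall m, (k < m < N)%N -> a m.+1 * t < a m) ->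
  0 <= (-1) ^+ k.+1 * (section a k).[- t] ->
  forall m, (k < m <= N)%N ->
   if odd (m - k.+1) then 0 < (-1) ^+ k.+1 * (section a m).[- t]
   else a m * t ^+ m <= (-1) ^+ k.+1 * (section a m).[- t].
Proof.
move=> apos kN t0 hmono h0; elim=> [//|m IH] /andP[km mN].
have am i : (i <= N)%N -> 0 < a i * t ^+ i by move=> iN; rewrite mulr_gt0 ?apos ?exprn_gt0.
have stepE : (-1) ^+ k.+1 * (section a m.+1).[- t] = (-1) ^+ k.+1 * (section a m).[- t] +
   (-1) ^+ (m - k) * (a m.+1 * t ^+ m.+1).
  rewrite section_recS hornerD hornerZ hornerXn mulrDr; congr (_ + _).
  have -> : (- t) ^+ m.+1 = (-1) ^+ m.+1 * t ^+ m.+1 by rewrite -exprMn mulN1r.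
  rewrite mulrCA [in RHS]mulrCA; congr (_ * _); rewrite mulrA -exprD; congr (_ * _).
  have oE : odd (k.+1 + m.+1) = odd (m - k).
    by rewrite oddB // oddD /=; case: (odd k); case: (odd m).
  by rewrite -[LHS]signr_odd oE signr_odd.
move: km; rewrite ltnS leq_eqVlt => /orP[/eqP kE|km].
  by rewrite -kE in stepE *; rewrite subnn /= stepE subnn expr0 mul1r lerDr.
have {IH} := IH ltac:(by rewrite km ltnW).
have mk : (m - k = (m - k.+1).+1)%N by rewrite subnSK.
have hm : a m.+1 * t < a m.
  by apply: hmono; rewrite km.
have sg : (-1) ^+ (m - k) = (-1) ^+ (~~ odd (m - k.+1)) :> R by rewrite mk -[LHS]signr_odd.
rewrite subSS stepE sg mk /=.
case: (odd (m - k.+1)) => /= h; first by rewrite expr0 mul1r lerDr ltW.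
rewrite expr1 mulN1r subr_gt0; apply: lt_le_trans h.
by rewrite exprS mulrA ltr_pM2r // exprn_gt0.
Qed.

(** With [s_k] the points given by [humps], the section of degree [N] takes
    values of alternating signs, the last one possibly zero, at 0 and at the
    points [- a_(k-1) / (a_k s_k)], which yields [N - 1] distinct roots. *)
Lemma hyperbolic_of_humps a N : (forall i, (i <= N)%N -> 0 < a i) -> humps a N ->
  (0 < N)%N -> hyperbolic (section a N).
Proof.
move=> apos hh N0; have th := humps_thirds apos hh.
pose f := section a N.
have yq j : (0 < j < N)%N -> 0 < inv_quotient a j.
  case: j => // j /andP[_ jN]; apply: inv_quotient_gt0 => // i hi.
  by apply: apos; apply: leq_trans hi jN.
(* the ratios [a_(m-1) / a_m] increase with [m] *)
have grow k m (t : R) : (0 < k)%N -> (k <= m < N)%N -> 0 < t -> t * a k <= a k.-1 ->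
  a m.+1 * t < a m.
  move=> k0; elim: m => [|m IH] /andP[km mN] t0 tk; first
    by rewrite leqn0 in km; rewrite (eqP km) in k0.
  have am1 : 0 < a m.+1 by apply: apos; apply: ltnW.
  have am2 : 0 < a m.+2 by apply: apos.
  have am0 : 0 < a m by apply: apos; apply: ltnW; apply: ltnW.
  have tm : a m.+1 * t <= a m.
    move: km; rewrite leq_eqVlt => /orP[/eqP kE|km]; first by move: tk; rewrite kE /= mulrC.
    by apply/ltW/IH => //; rewrite -ltnS km ltnW.
  have /andP[_ y3] := th m.+1 mN.
  rewrite -(ltr_pM2l am1) mulrCA.
  apply: le_lt_trans (_ : a m.+2 * a m < _); first by rewrite ler_wpM2l // ltW.
  have : inv_quotient a m.+1 < 1 by apply: le_lt_trans y3 _; clear; lra.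
  by rewrite /= ltr_pdivrMr ?exprn_gt0 // mul1r expr2 mulrC.
(* [- t] is the point number [k - 1], counted from 0, and [rs] lists the roots found
   to its right; the sign at the last point may vanish *)
suff H k : (0 < k <= N)%N -> exists (t : R) (rs : seq R),
    [/\ 0 <= t, (k < N)%N -> t * a k <= a k.-1, size rs = k.-1, uniq rs &
     [/\ all (root f) rs, all (fun r => - t <= r) rs,
         (k < N)%N -> 0 < (-1) ^+ k.+1 * f.[- t] &
         0 <= (-1) ^+ k.+1 * f.[- t]]].
  have [|t [rs [_ _ sz urs [rrs _ _ _]]]] := H N; first by rewrite N0 leqnn.
  apply: (hyperbolic_of_roots (rs := rs)) => //.
  by rewrite section_size ?gt_eqF ?apos // sz prednK.
elim: k => [//|k IH] /andP[_ kN]; case: k IH kN => [_ kN|k IH kN].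
  have f0 : 0 < (-1) ^+ 2 * f.[- 0].
    by rewrite expr2 mulrNN !mul1r oppr0; apply: section_pos.
  by exists 0, [::]; split => //; [rewrite mul0r ltW // apos|split => //; exact: ltW].
have [|t [rs [t0 tk sz urs [rrs trs fpos _]]]] := IH; first by rewrite /= ltnW.
have {}tk := tk kN; have {}fpos := fpos kN.
have [s /andP[s0 s1] hs] : exists2 s : R, 0 < s <= 1 &
  inv_quotient a k.+1 <= s * (psi (inv_quotient a) k.+1).[s] by apply: hh.
have a0 : 0 < a k by apply: apos; apply: ltnW; apply: ltnW.
have a1 : 0 < a k.+1 by apply: apos; apply: ltnW.
have a2 : 0 < a k.+2 by apply: apos.
pose t' := a k / (a k.+1 * s).
have t'0 : 0 < t' by rewrite divr_gt0 // mulr_gt0.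
have tt' : t <= t'.
  rewrite /t' ler_pdivlMr ?mulr_gt0 //.
  apply: le_trans tk; rewrite mulrA ler_piMr // mulr_ge0 // ltW //.
have Y0 : 0 < inv_quotient a k.+1 by apply: yq.
(* by [section_psi] the sign is that of [- psi_(k+2)(s / y_(k+1))], where
   [psi_(k+2)(s / y_(k+1)) = 1 - s psi_(k+1)(s) / y_(k+1)] *)
have Fk : 0 <= (-1) ^+ k.+3 * (section a k.+2).[- t'].
  rewrite (section_psi (a := a)) //; last by move=> i hi; apply: apos; apply: leq_trans kN.
  have sgn2 : (-1) ^+ k.+3 * (-1) ^+ k.+2 = -1 :> R.
    by rewrite -exprD -signr_odd addSn addnn /= odd_double expr1.
  rewrite mulrA [(-1) ^+ k.+3 * (_ * _)]mulrA sgn2.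
  have -> : a k.+2.-1 / (a k.+2 * t') = s / inv_quotient a k.+1.
    rewrite /t' /=; field; rewrite !gt_eqF //.
  have -> : (psi (inv_quotient a) k.+2).[s / inv_quotient a k.+1] =
      1 - s / inv_quotient a k.+1 * (psi (inv_quotient a) k.+1).[s].
    by rewrite psiS [inv_quotient a k.+1 * _]mulrC divfK ?gt_eqF.
  rewrite -mulrA mulN1r -mulrN mulr_ge0 //; first by rewrite mulr_ge0 ?exprn_ge0 // ltW.
  rewrite oppr_ge0 subr_le0 mulrAC ler_pdivlMr // mul1r; exact: hs.
have tk' : (k.+2 < N)%N -> t' * a k.+2 <= a k.+1.
  move=> _; rewrite /t' mulrAC ler_pdivrMr ?mulr_gt0 //.
  have ys : inv_quotient a k.+1 <= s.
    apply: le_trans hs _; rewrite ler_piMr ?(ltW s0) //.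
    have hth : thirds (inv_quotient a) k.+1 by move=> i hi; apply: th; apply: ltn_trans kN.
    by have /andP[] := psi_range hth (introT andP (conj (ltW s0) s1)).
  move: ys; rewrite /= ler_pdivrMr ?exprn_gt0 // => /le_trans; apply.
  by rewrite expr2 mulrC mulrA.
have fs : (k.+2 < N)%N -> 0 < (-1) ^+ k.+3 * f.[- t'].
  move=> kN2.
  have := @tail_sign a N k.+2 t' apos kN2 t'0 _ Fk N ltac:(by rewrite kN2 /=).
  have mono m : (k.+2 < m < N)%N -> a m.+1 * t' < a m.
    by case/andP=> km mN; apply: (grow k.+2) => //; [rewrite ltnW|exact: tk'].
  case: (odd _); first by apply.
  by move=> h; apply: lt_le_trans (h mono); rewrite mulr_gt0 ?exprn_gt0 ?apos.
have fs0 : 0 <= (-1) ^+ k.+3 * f.[- t'].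
  by move: kN; rewrite leq_eqVlt => /orP[/eqP kE|/fs/ltW//]; rewrite /f -kE.
(* a new root between the two points *)
have [r /andP[r1 r2] rr] : exists2 r : R, - t' <= r <= - t & root f r.
  pose g := (-1) ^+ k.+3 *: f.
  have [||r hr rg] := @poly_ivt R (- g) (- t') (- t); first by rewrite lerN2.
    rewrite !hornerN !hornerZ oppr_le0 fs0 /= oppr_ge0.
    by rewrite exprS -mulrA mulN1r oppr_le0 ltW.
  by exists r => //; move: rg; rewrite rootN rootZ // signr_eq0.
have rt : r < - t.
  rewrite lt_neqAle r2 andbT; apply/eqP => rE; move: fpos; rewrite -rE.
  by move/rootP: rr => ->; rewrite mulr0 ltxx.
exists t', (r :: rs); split => //=; first exact: ltW.
- by rewrite sz.
- rewrite urs andbT; apply/negP => rin.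
  by have := allP trs r rin; rewrite leNgt rt.
split => //; first by rewrite rr.
rewrite r1 /=; apply: sub_all trs => x; apply: le_trans; by rewrite lerN2.
Qed.

End Sufficient.

(** * The extremal sequence *)

Section Extremal.
Variable R : realType.
Implicit Types (a y : nat -> R) (n N : nat).

Lemma psi_ext y y' n : (forall j, (j < n)%N -> y j = y' j) -> psi y n = psi y' n.
Proof.
elim: n => [//|n IH] h /=; rewrite h // IH // => j jn.
by apply: h; rewrite ltnS ltnW.
Qed.

Lemma inv_quotient_ext a b k : (forall i, (i <= k.+1)%N -> a i = b i) ->
  inv_quotient a k = inv_quotient b k.
Proof. by case: k => [//|k] h; rewrite /= !h // ltnW // ltnW. Qed.

Lemma section_ext a b n : (forall i, (i <= n)%N -> a i = b i) -> section a n = section b n.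
Proof.
move=> h; apply/polyP => i; rewrite !coef_poly.
by case: (boolP (i < n.+1)%N) => // hi; rewrite h.
Qed.

(** [M] is the maximum of [s * psi_n(s)] on the unit interval, attained at a
    positive point. *)
Definition is_hump_max y n (M : R) :=
  (exists2 s : R, 0 < s <= 1 & M = s * (psi y n).[s]) /\
  forall s : R, 0 <= s <= 1 -> s * (psi y n).[s] <= M.

Lemma hump_max_exists y n : thirds y n -> exists M : R, is_hump_max y n M.
Proof.
move=> hy; have [|s] := @EVT_max R (horner ('X * psi y n)) 0 1 ler01.
  by apply: continuous_subspaceT; exact: continuous_horner.
rewrite in_itv /= => hs hm.
have {}hm (t : R) : 0 <= t <= 1 -> t * (psi y n).[t] <= s * (psi y n).[s].
  by move=> ht; have := hm t; rewrite !hornerM !hornerX in_itv /= => ->.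
exists (s * (psi y n).[s]); split=> //; exists s => //.
have h12 : 0 <= (1/2 : R) <= 1 by apply/andP; split; clear; lra.
have h := hm _ h12.
have /andP[g _] := psi_range hy h12.
case/andP: hs => s0 ->; rewrite lt_neqAle s0 !andbT.
apply/eqP => s00; move: h; rewrite -s00 mul0r; clear -g.
by set v := (_).[_] in g * => ?; lra.
Qed.

Lemma hump_max_gt0 y n (M : R) : thirds y n -> is_hump_max y n M -> 0 < M.
Proof.
move=> hy [_ h]; have h12 : 0 <= (1/2 : R) <= 1 by apply/andP; split; clear; lra.
have /andP[g _] := psi_range hy h12; have := h _ h12.
by clear -g; set v := (_).[_] in g * => ?; lra.
Qed.

Lemma max_coef_eq (q : {poly R}) n c : is_max_coef q n c -> max_coef q n = c.
Proof.
move=> hc; apply: xget_unique => // c' [c'0 hc' mc']; case: hc => c0 hc mc.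
by apply/eqP; rewrite eq_le mc // mc'.
Qed.

(** The sequence [a] up to index [n], constant equal to [c] afterwards. *)
Definition extend a n (c : R) i := if (i <= n)%N then a i else c.

Lemma extend_quotient a n c k : (k < n)%N ->
  inv_quotient (extend a n c) k = inv_quotient a k.
Proof. by move=> kn; apply: inv_quotient_ext => i ik; rewrite /extend (leq_trans ik). Qed.

Lemma extend_top a n c : inv_quotient (extend a n.+1 c) n.+1 = a n * c / a n.+1 ^+ 2.
Proof. by rewrite /= /extend leqnSn leqnn ltnn. Qed.

Lemma extend_section a n c : section (extend a n c) n.+1 = section a n + c *: 'X^(n.+1).
Proof.
rewrite section_recS /extend ltnn; congr (_ + _).
by apply: section_ext => i ->.
Qed.

(** The maximal next coefficient is the one whose reciprocal quotient is the
    maximum of the hump: larger values violate [hump_of_admissible], this one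
    satisfies [hyperbolic_of_humps]. *)
Lemma next_max_coef a n (M : R) : (forall i, (i <= n.+1)%N -> 0 < a i) -> humps a n.+1 ->
  is_hump_max (inv_quotient a) n.+1 M ->
  is_max_coef (section a n.+1) n.+2 (M * a n.+1 ^+ 2 / a n).
Proof.
move=> apos hh hM; have th := humps_thirds apos hh.
have M0 := hump_max_gt0 th hM; case: hM => -[s0 hs0 Ms0] Mmax.
have a0 : 0 < a n by rewrite apos.
have a1 : 0 < a n.+1 by rewrite apos.
have epos c : 0 < c -> forall i, (i <= n.+2)%N -> 0 < extend a n.+1 c i.
  by move=> c0 i _; rewrite /extend; case: ifP => // /apos.
have epsi c k : (k <= n.+1)%N ->
    psi (inv_quotient (extend a n.+1 c)) k = psi (inv_quotient a) k.
  by move=> kn; apply: psi_ext => j jk; rewrite extend_quotient // (leq_trans jk).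
split; first by rewrite divr_gt0 // mulr_gt0 // exprn_gt0.
  set c := _ / _; have c0 : 0 < c by rewrite divr_gt0 // mulr_gt0 // exprn_gt0.
  rewrite -extend_section; apply: hyperbolic_of_humps => //; first exact: epos.
  move=> k /andP[k0]; rewrite ltnS leq_eqVlt => /orP[/eqP->|kn].
    exists s0 => //; rewrite extend_top epsi // -Ms0 /c.
    rewrite le_eqVlt; apply/orP; left; apply/eqP; field.
    by rewrite !gt_eqF.
  have [s hs h] := hh k (introT andP (conj k0 kn)).
  by exists s => //; rewrite extend_quotient // epsi // ltnW.
move=> c c0 hyp.
have adm : admissible (inv_quotient (extend a n.+1 c)) n.+1.
  apply: admissible_of_hyperbolic; first exact: epos.
  move=> m /andP[m0]; rewrite leq_eqVlt => /orP[/eqP->|mn]; first by rewrite extend_section.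
  rewrite (@section_ext _ a) => [|i im]; last by rewrite /extend (leq_trans im).
  apply: hyperbolic_of_humps => //; first
    by move=> i im; apply: apos; apply: leq_trans im _.
  by move=> k /andP[k0 km]; apply: hh; rewrite k0 (leq_trans km).
have [|s hs] := @hump_of_admissible R _ n.+1 n.+1 adm; first by rewrite leqnn.
rewrite extend_top epsi // => h; have {h} := le_trans h (Mmax s hs).
by rewrite ler_pdivrMr ?exprn_gt0 // ler_pdivlMr // mulrC.
Qed.

Lemma A_0 : A_ R 0 = 1. Proof. by []. Qed.
Lemma A_1 : A_ R 1 = 1. Proof. by []. Qed.

(** The polynomials [p_n] are the sections of the sequence [A_n], and the
    reciprocal quotients of that sequence are the maxima of the humps. *)
Lemma A_structure n :
  [/\ forall i, (i <= n.+1)%N -> 0 < A_ R i, p_ R n.+1 = section (A_ R) n.+1 &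
  forall k, (0 < k <= n)%N -> is_hump_max (inv_quotient (A_ R)) k (inv_quotient (A_ R) k)].
Proof.
elim: n => [|n [apos pE hmax]].
  split=> [[|[|i]]//|| [|k]] //.
  rewrite section_recS /section poly_def big_ord1 expr0 A_0 A_1 !scale1r expr1.
  by rewrite /=.
have hh : humps (A_ R) n.+1.
  by move=> k /hmax[[s hs ->] _]; exists s.
have th := humps_thirds apos hh.
have [M hM] := hump_max_exists th.
have AE : A_ R n.+2 = M * A_ R n.+1 ^+ 2 / A_ R n.
  by apply: max_coef_eq; rewrite /= -/(p_ R n.+1) pE; apply: next_max_coef.
have a0 : 0 < A_ R n by rewrite apos.
have a1 : 0 < A_ R n.+1 by rewrite apos.
split.
- move=> i; rewrite leq_eqVlt => /orP[/eqP->|/apos//].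
  by rewrite AE divr_gt0 // mulr_gt0 ?exprn_gt0 // (hump_max_gt0 th).
- by rewrite section_recS -pE.
- move=> k /andP[k0]; rewrite leq_eqVlt => /orP[/eqP->|kn]; last by apply: hmax; rewrite k0.
  suff -> : inv_quotient (A_ R) n.+1 = M by [].
  by rewrite [LHS]/= AE; field; rewrite !gt_eqF.
Qed.

Lemma A_gt0 n : 0 < A_ R n.
Proof. by have [h _ _] := A_structure n; apply: h. Qed.

Lemma p_section n : p_ R n.+1 = section (A_ R) n.+1.
Proof. by have [] := A_structure n. Qed.

Lemma A_hump_max n : is_hump_max (inv_quotient (A_ R)) n.+1 (inv_quotient (A_ R) n.+1).
Proof. by have [_ _ h] := A_structure n.+1; apply: h; rewrite leqnn. Qed.

Lemma p_hyperbolic n : (0 < n)%N -> hyperbolic (section (A_ R) n).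
Proof.
move=> n0; apply: hyperbolic_of_humps => // [i _|[//|k] _]; first exact: A_gt0.
by have [[s hs ->] _] := A_hump_max k; exists s.
Qed.

Lemma A_thirds n : thirds (inv_quotient (A_ R)) n.
Proof.
apply: humps_thirds => [i _|[//|k] _]; first exact: A_gt0.
by have [[s hs ->] _] := A_hump_max k; exists s.
Qed.

Lemma A_extremal N : extremal (inv_quotient (A_ R)) N.
Proof.
set Y := inv_quotient (A_ R).
have Y1 : Y 1%N = 1/4.
  have [[s _ E] h] := A_hump_max 0.
  have h12 : 0 <= (1/2 : R) <= 1 by apply/andP; split; clear; lra.
  have := h _ h12; rewrite /Y E !psiS !psi0; clear => h.
  have := sqr_ge0 (s - 1/2); lra.
have up n : 0 < Y n.+1 <= 63/200.
  have [_ _ h _] : admissible Y n.+1; last by apply: h; rewrite /= leqnn.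
  apply: admissible_of_hyperbolic => [i _|m /andP[m0 _]]; first exact: A_gt0.
  exact: p_hyperbolic.
(* the hump is evaluated at [2/3] *)
have low n : 292/1000 <= Y n.+2.
  elim: n => [|n IH].
    have h23 : 0 <= (2/3 : R) <= 1 by apply/andP; split; clear; lra.
    have [_ /(_ _ h23)] := A_hump_max 1; rewrite -/Y 2!psiS psi0 Y1.
    by clear; set z := Y 2%N; lra.
  have h23 : 0 <= (2/3 : R) <= 1 by apply/andP; split; clear; lra.
  have [_ /(_ _ h23)] := A_hump_max n.+2; rewrite -/Y 2!psiS.
  have /andP[_ y1] := up n.+1; have /andP[z0 z1] := up n.
  have w0 : 0 <= Y n.+2 * (2/3) by clear -IH; lra.
  have x0 : 0 <= Y n.+1 * (Y n.+2 * (2/3)).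
    by apply: mulr_ge0; [exact: ltW|exact: w0].
  have x1 : Y n.+1 * (Y n.+2 * (2/3)) <= 63/200 * (63/200 * (2/3)).
    apply: ler_pM; [exact: ltW|exact: w0|by []|].
    by clear -y1; lra.
  have hx : 0 <= Y n.+1 * (Y n.+2 * (2/3)) <= 1.
    by apply/andP; split; [exact: x0|clear -x1; lra].
  have /andP[th0 _] := psi_range (@A_thirds n.+1) hx.
  have th1 : 93/100 <= (psi Y n.+1).[Y n.+1 * (Y n.+2 * (2/3))].
    apply: le_trans th0; clear -x1; lra.
  have yt : 292/1000 * (93/100) <= Y n.+2 * (psi Y n.+1).[Y n.+1 * (Y n.+2 * (2/3))].
    by apply: ler_pM => //; clear; lra.
  by clear -yt; lra.
split=> //.
- by move=> [|[|n]] //= hn; rewrite low /=; have /andP[] := up n.+1.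
- by move=> [//|n] s _; have [_ h] := A_hump_max n; apply: h.
Qed.

End Extremal.

(** * Section-hyperbolic polynomials *)

Section Minimizers.
Variable R : realType.
Implicit Types (a : nat -> R) (p q : {poly R}) (n : nat).

Lemma coef_quotientE a i : (0 < i)%N -> coef_quotient a i = (inv_quotient a i)^-1.
Proof. by case: i => // i _; rewrite /coef_quotient /= invf_div. Qed.

Lemma section_Delta a n : a 0%N = 1 -> (forall i, (i <= n)%N -> 0 < a i) ->
  (forall m, (0 < m <= n)%N -> hyperbolic (section a m)) -> Delta_ R n (section a n).
Proof.
move=> a0 apos hyp; split.
- by rewrite section_size // gt_eqF // apos.
- by rewrite coef_poly.
- by move=> i /andP[_ im]; rewrite coef_poly ltnS im apos.
- move=> m hm; have -> : take_poly m.+1 (section a n) = section a m; last exact: hyp.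
  apply/polyP => j; rewrite coef_take_poly !coef_poly; case: ifP => // jm.
  by rewrite (leq_trans jm) //; case/andP: hm.
Qed.

Lemma Delta_section p n : Delta_ R n p ->
  [/\ p = section (nth 0 p) n, forall i, (i <= n)%N -> 0 < p`_i &
    forall m, (0 < m <= n)%N -> hyperbolic (section (nth 0 p) m)].
Proof.
case=> sp p0 ppos hyp; split.
- apply/polyP => j; rewrite coef_poly; case: ltnP => // jn.
  by rewrite nth_default // sp.
- by case=> [|i] hi; [rewrite p0|apply: ppos].
- move=> m hm; suff -> : section (nth 0 p) m = take_poly m.+1 p by apply: hyp.
  by apply/polyP => j; rewrite !coef_poly.
Qed.

(** The comparison theorem for the coefficients of a section-hyperbolic
    polynomial. *)
Lemma Delta_compare p n i : Delta_ R n p -> (0 < i < n)%N ->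
  inv_quotient (nth 0 p) i <= inv_quotient (A_ R) i /\
  (inv_quotient (nth 0 p) i = inv_quotient (A_ R) i ->
   forall j, (j <= i)%N -> inv_quotient (nth 0 p) j = inv_quotient (A_ R) j).
Proof.
case: i => // i /Delta_section[_ ppos hyp] hi.
have adm : admissible (inv_quotient (nth 0 p)) i.+1.
  apply: admissible_of_hyperbolic => [j hj|m /andP[m0 hm]].
    by apply: ppos; apply: leq_trans hi.
  by apply: hyp; rewrite m0 (leq_trans hm).
have [h _ e] := extremal_comparison adm (A_extremal R i.+1) (ltnSn i).
by split=> //; rewrite -subr_ge0.
Qed.

(** A sequence starting at 1 is determined by its quotients up to scaling, here
    for the quotients of [A]. *)
Lemma quotients_scaling a n : (forall i, (i <= n.+1)%N -> 0 < a i) -> a 0%N = 1 ->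
  (forall j, (j <= n)%N -> inv_quotient a j = inv_quotient (A_ R) j) ->
  forall j, (j <= n.+1)%N -> a j = a 1%N ^+ j * A_ R j.
Proof.
move=> apos a0 h; elim/ltn_ind => -[|[|j]] IH jn.
- by rewrite a0 expr0 mul1r.
- by rewrite expr1 mulr1.
have e0 := IH j (ltnW (ltnSn _)) (ltnW (ltnW jn)).
have e1 := IH j.+1 (ltnSn _) (ltnW jn).
have c0 : 0 < a 1%N by apply: apos; apply: leq_trans jn.
have E : a j.+2 = inv_quotient a j.+1 * a j.+1 ^+ 2 / a j.
  by rewrite /=; field; rewrite !gt_eqF ?apos // ltnW // ltnW.
rewrite E h // e0 e1 /= !exprS; field.
by rewrite expf_neq0 ?(gt_eqF (A_gt0 R _)) ?(gt_eqF c0).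
Qed.

Lemma scaled_quotient c a k : 0 < c ->
  inv_quotient (fun j => c ^+ j * a j) k = inv_quotient a k.
Proof.
case: k => //= k c0; have [->|ak] := eqVneq (a k.+1) 0.
  by rewrite mulr0 expr0n /= invr0 !mulr0.
rewrite !exprS; field; rewrite ak expf_neq0 ?gt_eqF //.
Qed.

Lemma scaled_section c a n :
  section a n \Po (c *: 'X) = section (fun j => c ^+ j * a j) n.
Proof.
by apply/polyP => j; rewrite coef_comp_scale !coef_poly; case: ifP => _;
  rewrite ?mul0r // mulrC.
Qed.

Lemma scaled_extremal_Delta c n : 0 < c -> Delta_ R n.+1 (p_ R n.+1 \Po (c *: 'X)).
Proof.
move=> c0; rewrite p_section scaled_section.
have apos i : 0 < c ^+ i * A_ R i by rewrite mulr_gt0 ?exprn_gt0 ?A_gt0.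
apply: section_Delta => // [|m /andP[m0 _]]; first by rewrite mul1r.
apply: hyperbolic_of_humps => // -[//|k] _; rewrite scaled_quotient //.
have [[s hs ->] _] := A_hump_max R k; exists s => //.
by rewrite (@psi_ext _ _ (inv_quotient (A_ R))) // => j _; rewrite scaled_quotient.
Qed.

Lemma scaled_extremal_quotient c i : (0 < i)%N -> 0 < c ->
  coef_quotient (nth 0 (p_ R i.+1 \Po (c *: 'X))) i = (inv_quotient (A_ R) i)^-1.
Proof.
move=> i0 c0; rewrite coef_quotientE //; congr (_^-1).
rewrite p_section scaled_section -(@scaled_quotient c (A_ R) i) //.
by apply: inv_quotient_ext => j hj; rewrite coef_poly ltnS hj.
Qed.

End Minimizers.

Theorem theorem2 (R : realType) (i : nat) (i_gt0 : (0 < i)%N) :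
  [/\ m_ R i = A_ R i ^+ 2 / (A_ R i.-1 * A_ R i.+1),
      Delta_ R i.+1 (p_ R i.+1) /\ coef_quotient (nth 0 (p_ R i.+1)) i = m_ R i,
      forall p : {poly R}, Delta R p -> (i.+1 < size p)%N ->
        coef_quotient (p_infty R) i <= coef_quotient (nth 0 p) i &
      forall p : {poly R}, minimizes_on (Delta_ R i.+1) i p <->
        exists2 c : R, 0 < c & p = p_ R i.+1 \Po (c *: 'X)].
Proof.
pose Yi := inv_quotient (A_ R) i.
have Y0 : 0 < Yi.
  by apply: inv_quotient_gt0 => // j _; apply: A_gt0.
have pE : p_ R i.+1 = p_ R i.+1 \Po (1 *: 'X) by rewrite scale1r comp_polyXr.
have pD : Delta_ R i.+1 (p_ R i.+1) by rewrite pE; apply: scaled_extremal_Delta.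
have pq : coef_quotient (nth 0 (p_ R i.+1)) i = Yi^-1.
  by rewrite pE scaled_extremal_quotient.
have AE : coef_quotient (A_ R) i = Yi^-1 by rewrite coef_quotientE.
have low n p : Delta_ R n p -> (i < n)%N -> Yi^-1 <= coef_quotient (nth 0 p) i.
  move=> hp hn; rewrite coef_quotientE //.
  have [h _] := Delta_compare hp (introT andP (conj i_gt0 hn)).
  have [_ ppos _] := Delta_section hp.
  rewrite lef_pV2 // posrE; apply: inv_quotient_gt0 => // j hj.
  by apply: ppos; apply: leq_trans hn.
have lowD p : Delta R p -> (i.+1 < size p)%N -> Yi^-1 <= coef_quotient (nth 0 p) i.
  by move=> [n _ hp] sp; apply: (low n) => //; case: hp sp => ->.
have mE : m_ R i = Yi^-1.
  apply/eqP; rewrite eq_le; apply/andP; split.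
    rewrite -pq; apply: ge_inf.
      by exists Yi^-1 => _ [p [hp sp] <-]; apply: lowD.
    exists (p_ R i.+1) => //; split; first by exists i.+1.
    by case: pD => ->.
  apply: lb_le_inf => [|_ [p [hp sp] <-]]; last exact: lowD.
  exists (coef_quotient (nth 0 (p_ R i.+1)) i); exists (p_ R i.+1) => //.
  by split; [exists i.+1|case: pD => ->].
split=> //.
- by rewrite mE -AE.
- by split=> //; rewrite pq mE.
- by move=> p hp sp; rewrite /p_infty AE; apply: lowD.
move=> p; split=> [[hp hmin]|[c c0 ->]]; last first.
  split; first exact: scaled_extremal_Delta.
  by move=> q hq; rewrite scaled_extremal_quotient //; apply: (low i.+1).
have [psec ppos _] := Delta_section hp.
have [h hY] := Delta_compare hp (introT andP (conj i_gt0 (ltnSn i))).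
have e : inv_quotient (nth 0 p) i = inv_quotient (A_ R) i.
  apply: invr_inj; apply/eqP; rewrite eq_le -!coef_quotientE // AE.
  by rewrite (low i.+1) // andbT -pq hmin.
exists p`_1; first exact: ppos.
rewrite p_section scaled_section [LHS]psec; apply: section_ext => j hj.
apply: (quotients_scaling (n := i)) => //; first by case: hp.
exact: hY e.
Qed.
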